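(* Let $0<a<\infty$ and $\Omega_{a,\infty}=\{x\in\mathbb{R}^2:|x|>a\}$. Let $v=(v_1,v_2)\in C^2(\overline{\Omega_{a,\infty}})$ be a flow solving the steady Euler equations $$v\cdot\nabla v+\nabla p=0\ \text{ and }\ \mathrm{div}\,v=0\ \text{ in }\Omega_{a,\infty}$$ (for some pressure $p$), with the boundary condition $v\cdot e_r=0$ on $C_a$, and such that $\inf_{\Omega_{a,\infty}}|v|>0$. If $v\cdot e_\theta>0$ on $C_a$, then $$\sup_{\Omega_{a,\infty}}\Big(\frac{\partial v_2}{\partial x_1}-\frac{\partial v_1}{\partial x_2}\Big)>0;$$ if $v\cdot e_\theta<0$ on $C_a$, then $$\inf_{\Omega_{a,\infty}}\Big(\frac{\partial v_2}{\partial x_1}-\frac{\partial v_1}{\partial x_2}\Big)<0.$$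
   Context: $|\cdot|$ is the Euclidean norm in $\mathbb{R}^2$; $C_r=\{x\in\mathbb{R}^2:|x|=r\}$. For $x=(x_1,x_2)\neq0$, $e_r(x)=x/|x|$ and $e_\theta(x)=(-x_2/|x|,x_1/|x|)$. Solutions $(v,p)$ of the Euler equations are understood in the classical sense: $v$ and $p$ are (at least) of class $C^1$ in the open domain and the equations hold at every point. *)

(* Defs.v *)
From Stdlib Require Export Reals.
From Coquelicot Require Export Coquelicot.

#[global] Open Scope R_scope.

(** Points and vectors of the plane are pairs [x : R * R].
    [enorm] unfolds to Coquelicot's [Cmod]. *)

Definition enorm (x : R * R) : R := sqrt (fst x ^ 2 + snd x ^ 2).

Definition dot (x y : R * R) : R := fst x * fst y + snd x * snd y.

Definition e_r (x : R * R) : R * R := (fst x / enorm x, snd x / enorm x).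

Definition e_theta (x : R * R) : R * R := (- snd x / enorm x, fst x / enorm x).

Definition circle (r : R) (x : R * R) : Prop := enorm x = r.

Definition Omega (a : R) (x : R * R) : Prop := a < enorm x.

Definition closure (D : R * R -> Prop) (x : R * R) : Prop :=
  forall P : R * R -> Prop, locally x P -> exists y, P y /\ D y.

(** [Derive] is total, so each use of [d1], [d2] below on a set is paired with
    [ex_d1], [ex_d2] on that set. *)

Definition d1 (f : R * R -> R) (x : R * R) : R :=
  Derive (fun t => f (t, snd x)) (fst x).

Definition d2 (f : R * R -> R) (x : R * R) : R :=
  Derive (fun t => f (fst x, t)) (snd x).

Definition ex_d1 (f : R * R -> R) (x : R * R) : Prop :=
  ex_derive (fun t => f (t, snd x)) (fst x).

Definition ex_d2 (f : R * R -> R) (x : R * R) : Prop :=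
  ex_derive (fun t => f (fst x, t)) (snd x).

(** Class C^k on an open set [D]: all iterated partial derivatives of order at
    most [k] exist and are continuous in [D]. *)

Fixpoint Ck (D : R * R -> Prop) (k : nat) (f : R * R -> R) : Prop :=
  continuous_on D f /\
  match k with
  | O => True
  | S k' =>
      (forall x, D x -> ex_d1 f x /\ ex_d2 f x) /\
      Ck D k' (d1 f) /\ Ck D k' (d2 f)
  end.

Definition extends_to_closure (D : R * R -> Prop) (f : R * R -> R) : Prop :=
  exists g : R * R -> R,
    continuous_on (closure D) g /\ forall x, D x -> g x = f x.

Fixpoint derivatives_extend (D : R * R -> Prop) (k : nat) (f : R * R -> R)
  : Prop :=
  extends_to_closure D f /\
  match k with
  | O => True
  | S k' => derivatives_extend D k' (d1 f) /\ derivatives_extend D k' (d2 f)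
  end.

(** Class C^k on the closure of an open set [D]: [f] is C^k in [D], it is
    continuous on the closure (so that its boundary values are the limits of
    its interior values), and all its partial derivatives of order at most [k]
    extend continuously from [D] to the closure.  Nothing is required of [f]
    outside the closure. *)

Definition Ck_closure (D : R * R -> Prop) (k : nat) (f : R * R -> R) : Prop :=
  Ck D k f /\ continuous_on (closure D) f /\ derivatives_extend D k f.

Definition comp1 (v : R * R -> R * R) (x : R * R) : R := fst (v x).

Definition comp2 (v : R * R -> R * R) (x : R * R) : R := snd (v x).

Definition divergence (v : R * R -> R * R) (x : R * R) : R :=
  d1 (comp1 v) x + d2 (comp2 v) x.

Definition vorticity (v : R * R -> R * R) (x : R * R) : R :=
  d1 (comp2 v) x - d2 (comp1 v) x.

(** The steady Euler equations in [D].  Regularity of [v] is not part of this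
    predicate. *)

Definition steady_Euler (D : R * R -> Prop) (v : R * R -> R * R)
    (p : R * R -> R) : Prop :=
  forall x, D x ->
    comp1 v x * d1 (comp1 v) x + comp2 v x * d2 (comp1 v) x + d1 p x = 0 /\
    comp1 v x * d1 (comp2 v) x + comp2 v x * d2 (comp2 v) x + d2 p x = 0 /\
    divergence v x = 0.

Definition inf_on (D : R * R -> Prop) (f : R * R -> R) : Rbar :=
  Glb_Rbar (fun y => exists x, D x /\ y = f x).

Definition sup_on (D : R * R -> Prop) (f : R * R -> R) : Rbar :=
  Lub_Rbar (fun y => exists x, D x /\ y = f x).

(* Main.v *)
Require Import Defs.
From Stdlib Require Import ZArith Lra Lia List.

(** Let [v] be counterclockwise on the inner circle and suppose that its
    vorticity is nonpositive.  With a stream function [u] ([v = J grad u]),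
    consider the flow of [W = grad u / |grad u|^2], which exists for all times
    because [|W| = 1 / |v|] is bounded, and along which [u] grows at unit speed.
    As [v . W = 0] and [div v = 0], the variation [h] of a trajectory satisfies
    [(v . h)' = omega (v . h) / |v|^2] and [(grad u . h)' = 0], so the flow does
    not expand the metric [|v|^2 |dx|^2].  Hence the images of the inner circle
    are loops around the hole of uniformly bounded Euclidean length.  They stay
    in a bounded region, where [u] is bounded: a contradiction.

    The argument is carried out in logarithmic polar coordinates, where loops
    are curves with a period shift, and with the explicit Euler scheme in place
    of the flow: the image curves are then smooth by construction, and the
    non-expansion holds up to a factor [1 + eps dt] per step.  The curves start
    from a circle slightly inside the domain, where [A = e^s v . e_r] is small
    instead of zero; the function [int B ds] replacing [u] then still grows at
    least at speed 1/2 along [W]. *)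

(** * Plane calculus on periodic strips *)

(** The criterion is asymmetric: the mean value theorem and the continuity of [f1] control
    increments in the first variable, so that in the second a derivative at the single point
    suffices. *)
Lemma differentiable_of_partials (f f1 : R -> R -> R) (x y l : R) :
  locally_2d (fun u v => is_derive (fun t => f t v) u (f1 u v)) x y ->
  is_derive (f x) y l ->
  continuity_2d_pt f1 x y ->
  differentiable_pt_lim f x y (f1 x y) l.
Proof.
intros H1 H2 H3.
apply filterdiff_differentiable_pt_lim.
apply (is_derive_filterdiff f x y f1 l).
- now apply locally_2d_locally in H1.
- exact H2.
- now apply continuity_2d_pt_filterlim.
Qed.

Lemma is_derive_comp_2d (f : R -> R -> R) (g h : R -> R) (x l1 l2 dg dh : R) :
  differentiable_pt_lim f (g x) (h x) l1 l2 ->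
  is_derive g x dg -> is_derive h x dh ->
  is_derive (fun t => f (g t) (h t)) x (l1 * dg + l2 * dh).
Proof.
intros Hf Hg Hh.
apply is_derive_Reals.
apply derivable_pt_lim_comp_2d; trivial; now apply is_derive_Reals.
Qed.

Lemma differentiable_is_derive_1 (f : R -> R -> R) (x y l1 l2 : R) :
  differentiable_pt_lim f x y l1 l2 -> is_derive (fun t => f t y) x l1.
Proof.
intros H.
replace l1 with (l1 * 1 + l2 * 0) by ring.
apply (is_derive_comp_2d f (fun t => t) (fun _ => y)); trivial.
- apply @is_derive_id.
- apply @is_derive_const.
Qed.

Lemma differentiable_is_derive_2 (f : R -> R -> R) (x y l1 l2 : R) :
  differentiable_pt_lim f x y l1 l2 -> is_derive (f x) y l2.
Proof.
intros H.
replace l2 with (l1 * 0 + l2 * 1) by ring.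
apply (is_derive_comp_2d f (fun _ => x) (fun t => t)); trivial.
- apply @is_derive_const.
- apply @is_derive_id.
Qed.

Lemma continuous_curry_1 (f : R -> R -> R) (x y : R) :
  continuity_2d_pt f x y -> continuous (fun t => f t y) x.
Proof.
intros H.
apply (continuous_comp_2 (fun t : R => t) (fun _ => y) f).
- apply continuous_id.
- apply continuous_const.
- now apply continuity_2d_pt_filterlim.
Qed.

Lemma continuous_curry_2 (f : R -> R -> R) (x y : R) :
  continuity_2d_pt f x y -> continuous (f x) y.
Proof.
intros H.
apply (continuous_comp_2 (fun _ => x) (fun t : R => t) f).
- apply continuous_const.
- apply continuous_id.
- now apply continuity_2d_pt_filterlim.
Qed.

Definition periodic (f : R -> R -> R) : Prop :=
  forall s p, f s (p + 2 * PI) = f s p.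

Lemma periodic_nat (f : R -> R -> R) (s p : R) (n : nat) :
  periodic f -> f s (p + INR n * (2 * PI)) = f s p.
Proof.
intros H; induction n as [|n IH].
- simpl; f_equal; ring.
- rewrite <- IH, <- (H s (p + INR n * (2 * PI))), S_INR; f_equal; ring.
Qed.

Lemma periodic_Z (f : R -> R -> R) (s p : R) (z : Z) :
  periodic f -> f s (p + IZR z * (2 * PI)) = f s p.
Proof.
intros H; destruct (Z_le_dec 0 z) as [Hz|Hz].
- rewrite <- (Z2Nat.id z) by lia; rewrite <- INR_IZR_INZ; now apply periodic_nat.
- rewrite <- (periodic_nat f s (p + IZR z * (2 * PI)) (Z.to_nat (- z)) H).
  rewrite INR_IZR_INZ, Z2Nat.id by lia.
  rewrite opp_IZR; f_equal; ring.
Qed.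

Lemma reduce_angle (p : R) :
  exists z : Z, 0 <= p + IZR z * (2 * PI) <= 2 * PI.
Proof.
pose proof PI_RGT_0 as Hpi.
exists (1 - up (p / (2 * PI)))%Z.
rewrite minus_IZR.
destruct (archimed (p / (2 * PI))) as [H1 H2].
set (k := IZR (up (p / (2 * PI)))) in *.
assert (E : p = p / (2 * PI) * (2 * PI)) by (field; lra).
set (q := p / (2 * PI)) in *.
rewrite E; split; nra.
Qed.

(** The angles range over all of R, so one modulus [d] serves a curve however often it turns around
    the hole. *)
Definition unif_on_strip (S0 S1 eps d : R) (f : R -> R -> R) : Prop :=
  forall s p s' p', S0 <= s <= S1 -> S0 <= s' <= S1 ->
    Rabs (s' - s) < d -> Rabs (p' - p) < d ->
    Rabs (f s' p' - f s p) < eps.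

Definition continuous_strip (S0 S1 : R) (f : R -> R -> R) : Prop :=
  periodic f /\ forall s p, S0 <= s <= S1 -> continuity_2d_pt f s p.

Lemma unif_on_strip_exists (S0 S1 eps : R) (f : R -> R -> R) :
  continuous_strip S0 S1 f -> 0 < eps ->
  exists d, 0 < d /\ unif_on_strip S0 S1 eps d f.
Proof.
intros [Hp Hc] Heps.
(* Once [p] is reduced to [[0, 2 * PI]], the margin 1 on both sides keeps [p'] in the rectangle. *)
destruct (uniform_continuity_2d f S0 S1 (-1) (2 * PI + 1)
  (fun s p Hs _ => Hc s p Hs) (mkposreal eps Heps)) as [d Hd].
exists (Rmin d 1); split.
{ apply Rmin_pos; [apply cond_pos | lra]. }
intros s p s' p' Hs Hs' H1 H2.
pose proof (Rmin_l d 1); pose proof (Rmin_r d 1).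
destruct (reduce_angle p) as [z Hz].
rewrite <- (periodic_Z f s p z Hp), <- (periodic_Z f s' p' z Hp).
assert (Rabs (p' - p) < 1) as H3 by lra.
apply Rabs_def2 in H3.
apply Hd; simpl; trivial; try lra.
replace (p' + IZR z * (2 * PI) - (p + IZR z * (2 * PI))) with (p' - p) by ring.
lra.
Qed.

Lemma unif_on_strip_exists_list (S0 S1 eps : R) (l : list (R -> R -> R)) :
  Forall (continuous_strip S0 S1) l -> 0 < eps ->
  exists d, 0 < d /\ Forall (unif_on_strip S0 S1 eps d) l.
Proof.
intros H Heps; induction H as [|f l Hf Hl [d [Hd IH]]].
- exists 1; split; [lra | constructor].
- destruct (unif_on_strip_exists S0 S1 eps f Hf Heps) as [d' [Hd' Hu]].
  exists (Rmin d d'); split; [now apply Rmin_pos |].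
  pose proof (Rmin_l d d'); pose proof (Rmin_r d d').
  constructor.
  + intros s p s' p' ? ? ? ?; apply Hu; trivial; lra.
  + eapply Forall_impl; [| exact IH].
    intros g Hg s p s' p' ? ? ? ?; apply Hg; trivial; lra.
Qed.

Lemma bounded_on_strip_exists (S0 S1 : R) (f : R -> R -> R) :
  continuous_strip S0 S1 f ->
  exists M, 0 <= M /\ forall s p, S0 <= s <= S1 -> Rabs (f s p) <= M.
Proof.
intros Hf.
destruct (unif_on_strip_exists S0 S1 1 f Hf Rlt_0_1) as [d [Hd Hu]].
(* a point at distance at most [n * d / 2] from the corner is reached in [n] steps *)
assert (Hn : forall (n : nat) s p, S0 <= s <= S1 -> s - S0 <= INR n * (d / 2) ->
          0 <= p <= INR n * (d / 2) -> Rabs (f s p) <= Rabs (f S0 0) + INR n).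
{ induction n as [|n IH]; intros s p Hs H1 H2.
  - simpl in *; replace s with S0 by lra; replace p with 0 by lra; lra.
  - rewrite S_INR in *.
    assert (Hs' : exists s', S0 <= s' <= s /\ s - s' <= d / 2 /\ s' - S0 <= INR n * (d / 2)).
    { destruct (Rle_dec (s - d / 2) S0).
      - exists S0; pose proof (pos_INR n); repeat split; try lra; nra.
      - exists (s - d / 2); lra. }
    assert (Hp' : exists p', 0 <= p' <= p /\ p - p' <= d / 2 /\ p' <= INR n * (d / 2)).
    { destruct (Rle_dec (p - d / 2) 0).
      - exists 0; pose proof (pos_INR n); repeat split; try lra; nra.
      - exists (p - d / 2); lra. }
    destruct Hs' as [s' Hs'], Hp' as [p' Hp'].
    specialize (IH s' p' ltac:(lra) ltac:(lra) ltac:(lra)).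
    assert (Rabs (f s p - f s' p') < 1).
    { apply Hu; try lra; apply Rabs_def1; lra. }
    pose proof (Rabs_triang (f s p - f s' p') (f s' p')) as Ht.
    replace (f s p - f s' p' + f s' p') with (f s p) in Ht by ring.
    lra. }
destruct (INR_unbounded ((Rabs (S1 - S0) + 2 * PI) / (d / 2))) as [n Hn'].
apply Rmult_lt_compat_r with (r := d / 2) in Hn'; [| lra].
replace ((Rabs (S1 - S0) + 2 * PI) / (d / 2) * (d / 2))
  with (Rabs (S1 - S0) + 2 * PI) in Hn' by (field; lra).
pose proof PI_RGT_0; pose proof (Rle_abs (S1 - S0)); pose proof (Rabs_pos (S1 - S0)).
exists (Rabs (f S0 0) + INR n); split.
{ pose proof (Rabs_pos (f S0 0)); pose proof (pos_INR n); lra. }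
intros s p Hs.
destruct (reduce_angle p) as [z Hz].
rewrite <- (periodic_Z f s p z (proj1 Hf)).
apply Hn; lra.
Qed.

Lemma bounded_on_strip_exists_list (S0 S1 : R) (l : list (R -> R -> R)) :
  Forall (continuous_strip S0 S1) l ->
  exists M, 0 <= M /\
    Forall (fun f => forall s p, S0 <= s <= S1 -> Rabs (f s p) <= M) l.
Proof.
intros H; induction H as [|f l Hf Hl [M [HM IH]]].
- exists 0; split; [lra | constructor].
- destruct (bounded_on_strip_exists S0 S1 f Hf) as [M' [HM' Hb]].
  exists (Rmax M M'); split; [apply Rle_trans with M; trivial; apply Rmax_l |].
  pose proof (Rmax_l M M'); pose proof (Rmax_r M M').
  constructor.
  + intros s p Hs; specialize (Hb s p Hs); lra.
  + eapply Forall_impl; [| exact IH].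
    intros g Hg s p Hs; specialize (Hg s p Hs); lra.
Qed.

(** * The direction field of the stream function *)

(** [grad_dir V = - i / conj V]: if [V] is the velocity [J grad u] of a stream
    function [u], this is [grad u / |grad u|^2], along which [u] grows at unit
    speed; [dgrad_dir V U] is its derivative at [V] in the direction [U]. *)
Definition grad_dir (V : C) : C :=
  (snd V / (fst V ^ 2 + snd V ^ 2), - fst V / (fst V ^ 2 + snd V ^ 2)).

Definition dgrad_dir (V U : C) : C :=
  ((snd U * (fst V ^ 2 - snd V ^ 2) - 2 * fst V * snd V * fst U)
     / (fst V ^ 2 + snd V ^ 2) ^ 2,
   (fst U * (fst V ^ 2 - snd V ^ 2) + 2 * fst V * snd V * snd U)
     / (fst V ^ 2 + snd V ^ 2) ^ 2).

Lemma sq_norm_pos (V : C) : 0 < Cmod V -> 0 < fst V ^ 2 + snd V ^ 2.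
Proof.
intros H; unfold Cmod in H.
destruct (Rle_dec (fst V ^ 2 + snd V ^ 2) 0) as [H'|H']; [| lra].
rewrite sqrt_neg_0 in H; lra.
Qed.

Lemma Cmod_Ci : Cmod Ci = 1.
Proof.
unfold Cmod, Ci; simpl; replace (0 * (0 * 1) + 1 * (1 * 1)) with 1 by ring; apply sqrt_1.
Qed.

Lemma Cmod_grad_dir (V : C) : 0 < Cmod V -> Cmod (grad_dir V) = / Cmod V.
Proof.
intros H; pose proof (sq_norm_pos V H) as HQ.
assert (E : (grad_dir V * Cconj V = - Ci)%C).
{ unfold grad_dir, Cmult, Cconj, Copp, Ci; simpl in *; f_equal; field; lra. }
apply (f_equal Cmod) in E.
rewrite Cmod_mult, Cmod_conj, Cmod_opp in E.
rewrite Cmod_Ci in E.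
apply (Rmult_eq_reg_r (Cmod V)); [rewrite E; field |]; lra.
Qed.

Lemma Cmod_dgrad_dir (V U : C) :
  0 < Cmod V -> Cmod (dgrad_dir V U) = Cmod U / Cmod V ^ 2.
Proof.
intros H; pose proof (sq_norm_pos V H) as HQ.
(* Differentiating [- i / conj V] gives [i conj U / (conj V)^2]. *)
assert (E : (dgrad_dir V U * (Cconj V * Cconj V) = Ci * Cconj U)%C).
{ unfold dgrad_dir, Cmult, Cconj, Copp, Ci; simpl in *; f_equal; field; lra. }
apply (f_equal Cmod) in E.
rewrite !Cmod_mult, !Cmod_conj in E.
rewrite Cmod_Ci in E.
apply (Rmult_eq_reg_r (Cmod V * Cmod V)); [rewrite E; field; lra | nra].
Qed.

Lemma is_derive_grad_dir (f g : R -> R) (x df dg : R) :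
  0 < Cmod (f x, g x) -> is_derive f x df -> is_derive g x dg ->
  is_derive (fun t => fst (grad_dir (f t, g t))) x
    (fst (dgrad_dir (f x, g x) (df, dg))) /\
  is_derive (fun t => snd (grad_dir (f t, g t))) x
    (snd (dgrad_dir (f x, g x) (df, dg))).
Proof.
intros H Hf Hg; pose proof (sq_norm_pos _ H) as HQ; simpl in HQ.
unfold grad_dir, dgrad_dir; simpl fst; simpl snd.
assert (ex_derive f x) by (eexists; exact Hf).
assert (ex_derive g x) by (eexists; exact Hg).
rewrite <- (is_derive_unique _ _ _ Hf), <- (is_derive_unique _ _ _ Hg).
split; auto_derive; repeat split; trivial; try lra;
  change (fun x => f x) with f; change (fun x => g x) with g; field; lra.
Qed.

(* The derivative of [conj V * h] along the direction field, for a field [V]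
   with Jacobian columns [V1], [V2]: only the curl and the divergence enter. *)
Lemma grad_dir_variation (V V1 V2 h : C) :
  0 < Cmod V -> fst V1 + snd V2 = 0 ->
  let W := grad_dir V in
  let dV k := (fst k * fst V1 + snd k * fst V2, fst k * snd V1 + snd k * snd V2) in
  (Cconj (dV W) * h + Cconj V * dgrad_dir V (dV h))%C =
  RtoC ((snd V1 - fst V2) / Cmod V ^ 2 * Re (Cconj V * h)).
Proof.
intros H Hdiv W dV; pose proof (sq_norm_pos V H) as HQ.
assert (EQ : Cmod V ^ 2 = fst V ^ 2 + snd V ^ 2).
{ unfold Cmod; rewrite pow2_sqrt; lra. }
rewrite EQ.
unfold W, dV, grad_dir, dgrad_dir, Cplus, Cmult, Cconj, RtoC, Re; simpl fst; simpl snd.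
replace (fst V1) with (- snd V2) by lra.
f_equal; field; lra.
Qed.

(** The real part is multiplied by [1 + t], which lies in [[-1, 1]], and the imaginary part is kept.
    For [z = conj V * h] these parts are [v . h] and [- grad u . h]. *)
Lemma Cmod_shrink_Re (z : C) (t : R) :
  -2 <= t <= 0 -> Cmod (z + RtoC (t * Re z)) <= Cmod z.
Proof.
intros Ht; unfold Cmod; apply sqrt_le_1_alt.
unfold Cplus, RtoC, Re; simpl.
destruct z as [x y]; simpl.
assert ((x + t * x) * ((x + t * x) * 1) = (1 + t) ^ 2 * (x * x)) as -> by ring.
assert ((1 + t) ^ 2 <= 1) by nra.
assert (0 <= x * x) by nra; nra.
Qed.

(* Along the direction field, the density [|V| |h|] of the metric [|V|^2 |dx|^2]
   does not increase to first order when the curl is nonpositive. *)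
Lemma grad_dir_step (V V1 V2 h E : C) (dt : R) :
  0 < Cmod V -> fst V1 + snd V2 = 0 -> snd V1 - fst V2 <= 0 ->
  0 <= dt -> -2 <= dt * ((snd V1 - fst V2) / Cmod V ^ 2) ->
  let W := grad_dir V in
  let dV k := (fst k * fst V1 + snd k * fst V2, fst k * snd V1 + snd k * snd V2) in
  let Z := dV W in
  let Y := dgrad_dir V (dV h) in
  Cmod (V + dt * (Z + E)) * Cmod (h + dt * Y) <=
  Cmod V * Cmod h + dt * (Cmod E * Cmod (h + dt * Y) + dt * (Cmod Z * Cmod Y)).
Proof.
intros H Hdiv Hcurl Hdt Hsmall W dV Z Y.
pose proof (grad_dir_variation V V1 V2 h H Hdiv) as Hvar.
cbv zeta in Hvar; fold dV in Hvar; fold W in Hvar; fold Z in Hvar; fold Y in Hvar.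
set (k := (snd V1 - fst V2) / Cmod V ^ 2) in *.
assert (Hk : k <= 0).
{ unfold k; apply Rmult_le_reg_r with (Cmod V ^ 2); [nra |].
  replace ((snd V1 - fst V2) / Cmod V ^ 2 * Cmod V ^ 2) with (snd V1 - fst V2) by (field; lra).
  lra. }
rewrite <- (Cmod_conj (V + dt * (Z + E))), <- Cmod_mult, <- (Cmod_conj V), <- Cmod_mult.
(* In the expanded product the first-order terms without [E] only rescale [Re (conj V * h)], by
   [grad_dir_variation]. What remains comes from the Taylor defect [E] and from the second-order
   product of [Z] and [Y]. *)
assert (Eq : (Cconj (V + dt * (Z + E)) * (h + dt * Y) =
  (Cconj V * h + RtoC (dt * k * Re (Cconj V * h))) +
  RtoC dt * (Cconj E * (h + dt * Y) + RtoC dt * (Cconj Z * Y)))%C).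
{ rewrite Rmult_assoc, RtoC_mult, <- Hvar.
  rewrite Cplus_conj, Cmult_conj, Cplus_conj.
  replace (Cconj (RtoC dt)) with (RtoC dt).
  - ring.
  - unfold Cconj, RtoC; simpl; f_equal; ring. }
rewrite Eq.
eapply Rle_trans; [apply Cmod_triangle |].
apply Rplus_le_compat.
- apply Cmod_shrink_Re; split; nra.
- rewrite Cmod_mult, Cmod_R, Rabs_pos_eq by trivial.
  apply Rmult_le_compat_l; trivial.
  eapply Rle_trans; [apply Cmod_triangle |].
  rewrite !Cmod_mult, !Cmod_conj, Cmod_R, Rabs_pos_eq by trivial.
  lra.
Qed.

(** * Flows in logarithmic polar coordinates *)

(** A planar flow in the coordinates [x = e^s (cos p, sin p)]: [A = e^s v.e_r],
    [B = e^s v.e_theta].  These coordinates are conformal, so the curl and the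
    divergence of [(A, B)] in [(s, p)] are [e^(2 s)] times those of [v]. *)
Record polar_flow (s0 c : R) (A B A1 A2 B1 B2 : R -> R -> R) : Prop := {
  pf_c : 0 < c;
  pf_per : Forall periodic (A :: B :: A1 :: A2 :: B1 :: B2 :: nil);
  pf_cont : forall s p, s0 <= s -> Forall (fun f => continuity_2d_pt f s p) (A :: B :: nil);
  pf_cont1 : forall s p, s0 < s ->
    Forall (fun f => continuity_2d_pt f s p) (A1 :: A2 :: B1 :: B2 :: nil);
  pf_A : forall s p, s0 < s -> differentiable_pt_lim A s p (A1 s p) (A2 s p);
  pf_B : forall s p, s0 < s -> differentiable_pt_lim B s p (B1 s p) (B2 s p);
  pf_div : forall s p, s0 < s -> A1 s p + B2 s p = 0;
  pf_curl : forall s p, s0 < s -> B1 s p - A2 s p <= 0;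
  pf_lower : forall s p, s0 < s -> c * exp s <= Cmod (A s p, B s p);
  pf_bdA : forall p, A s0 p = 0;
  pf_bdB : forall p, 0 < B s0 p }.

Lemma pf_strip s0 c A B A1 A2 B1 B2 (F : polar_flow s0 c A B A1 A2 B1 B2) S0 S1 :
  s0 < S0 -> Forall (continuous_strip S0 S1) (A :: B :: A1 :: A2 :: B1 :: B2 :: nil).
Proof.
intros H.
assert (Hc : forall s p, S0 <= s <= S1 ->
  Forall (fun f => continuity_2d_pt f s p) (A :: B :: A1 :: A2 :: B1 :: B2 :: nil)).
{ intros s p Hs.
  pose proof (pf_cont _ _ _ _ _ _ _ _ F s p ltac:(lra)) as H1.
  pose proof (pf_cont1 _ _ _ _ _ _ _ _ F s p ltac:(lra)) as H2.
  apply (Forall_app _ (A :: B :: nil)); split; trivial. }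
pose proof (pf_per _ _ _ _ _ _ _ _ F) as Hp.
rewrite Forall_forall in *.
intros f Hf; split; [now apply Hp |].
intros s p Hs; specialize (Hc s p Hs).
rewrite Forall_forall in Hc; now apply Hc.
Qed.

(** The derivatives are continuous only above [s0], so uniform estimates call for a start at
    [s1 > s0]. The collar from [s1] to [s2] is a barrier: [B >= 0] makes the direction field point
    outwards there. *)
Lemma start_circle s0 c A B A1 A2 B1 B2 (F : polar_flow s0 c A B A1 A2 B1 B2) :
  exists s1 s2, s0 < s1 < s2 /\
    (forall s p, s0 <= s <= s2 -> 0 <= B s p) /\
    forall p, Rabs (A s1 p) <= c * exp s0 / 2.
Proof.
pose proof (pf_c _ _ _ _ _ _ _ _ F) as Hc.
pose proof (exp_pos s0) as He.
assert (HF : Forall (continuous_strip s0 (s0 + 1)) (A :: B :: nil)).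
{ pose proof (pf_per _ _ _ _ _ _ _ _ F) as Hp.
  apply (Forall_app _ (A :: B :: nil)) in Hp; destruct Hp as [Hp _].
  rewrite Forall_forall in *.
  intros f Hf; split; [now apply Hp |].
  intros s p Hs.
  pose proof (pf_cont _ _ _ _ _ _ _ _ F s p ltac:(lra)) as H.
  rewrite Forall_forall in H; now apply H. }
destruct (continuity_ab_min (B s0) 0 (2 * PI)) as [p0 [Hp0 _]].
{ pose proof PI_RGT_0; lra. }
{ intros p _; apply continuity_pt_filterlim; apply continuous_curry_2.
  apply Forall_inv_tail, Forall_inv in HF; apply HF; lra. }
pose proof (pf_bdB _ _ _ _ _ _ _ _ F p0) as Hb.
(* Near the boundary, [B] differs from its boundary values by less than their positive minimum
   [B s0 p0], and [A] differs from 0 by less than [c * exp s0 / 2]. *)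
destruct (unif_on_strip_exists_list s0 (s0 + 1) (Rmin (B s0 p0) (c * exp s0 / 2)) _ HF)
  as [d [Hd Hu]].
{ apply Rmin_pos; nra. }
pose proof (Forall_inv Hu) as HuA.
pose proof (Forall_inv (Forall_inv_tail Hu)) as HuB.
pose proof (Rmin_l d 1); pose proof (Rmin_r d 1).
assert (0 < Rmin d 1) by (apply Rmin_pos; lra).
pose proof (Rmin_l (B s0 p0) (c * exp s0 / 2)); pose proof (Rmin_r (B s0 p0) (c * exp s0 / 2)).
exists (s0 + Rmin d 1 / 4), (s0 + Rmin d 1 / 2); split; [lra | split].
- intros s p Hs.
  destruct (reduce_angle p) as [z Hz].
  assert (HpB : periodic B).
  { apply Forall_inv_tail, Forall_inv in HF; apply HF. }
  rewrite <- (periodic_Z B s p z HpB).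
  set (q := p + IZR z * (2 * PI)) in *.
  specialize (HuB s0 q s q ltac:(lra) ltac:(lra)).
  specialize (HuB ltac:(apply Rabs_def1; lra) ltac:(apply Rabs_def1; lra)).
  specialize (Hp0 q Hz).
  apply Rabs_def2 in HuB; lra.
- intros p.
  specialize (HuA s0 p (s0 + Rmin d 1 / 4) p ltac:(lra) ltac:(lra)).
  specialize (HuA ltac:(apply Rabs_def1; lra) ltac:(apply Rabs_def1; lra)).
  rewrite (pf_bdA _ _ _ _ _ _ _ _ F), Rminus_0_r in HuA.
  lra.
Qed.

(** * First-order increments and the stream function *)

Definition C1_above (s0 : R) (f f1 f2 : R -> R -> R) : Prop :=
  forall s p, s0 < s -> differentiable_pt_lim f s p (f1 s p) (f2 s p).

(** A Taylor expansion whose remainder is uniform in [x]: the mean value theorem evaluates the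
    partials at a point of the segment, where each is within [eps] of its value at [x]. *)
Lemma segment_increment (s0 S0 S1 eps d : R) (f f1 f2 : R -> R -> R)
    (x w : R * R) (dt : R) :
  C1_above s0 f f1 f2 -> s0 < S0 -> 0 <= dt ->
  unif_on_strip S0 S1 eps d f1 -> unif_on_strip S0 S1 eps d f2 ->
  S0 <= fst x <= S1 -> S0 <= fst x + dt * fst w <= S1 -> dt * Cmod w < d ->
  Rabs (f (fst x + dt * fst w) (snd x + dt * snd w) - f (fst x) (snd x)
        - dt * (fst w * f1 (fst x) (snd x) + snd w * f2 (fst x) (snd x)))
  <= dt * (2 * eps * Cmod w).
Proof.
intros Hf HS Hdt H1 H2 Hx Hx' Hd.
destruct x as [s p], w as [u v]; simpl in *.
pose proof (Rmax_Cmod (u, v)) as Hm; simpl in Hm.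
pose proof (Rmax_l (Rabs u) (Rabs v)); pose proof (Rmax_r (Rabs u) (Rabs v)).
assert (Hs : forall t, 0 <= t <= dt -> S0 <= s + t * u <= S1).
{ intros t Ht; destruct (Rle_dec 0 u); split; nra. }
assert (Hder : forall t, 0 <= t <= dt ->
  is_derive (fun t => f (s + t * u) (p + t * v)) t
    (f1 (s + t * u) (p + t * v) * u + f2 (s + t * u) (p + t * v) * v)).
{ intros t Ht; specialize (Hs t Ht).
  apply (is_derive_comp_2d f (fun t => s + t * u) (fun t => p + t * v)).
  - cbv beta; apply Hf; lra.
  - auto_derive; trivial; ring.
  - auto_derive; trivial; ring. }
destruct (MVT_gen (fun t => f (s + t * u) (p + t * v)) 0 dt
  (fun t => f1 (s + t * u) (p + t * v) * u + f2 (s + t * u) (p + t * v) * v))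
  as [t [Ht Et]].
- intros t; rewrite Rmin_left, Rmax_right by lra; intros Ht; apply Hder; lra.
- intros t; rewrite Rmin_left, Rmax_right by lra; intros Ht.
  apply continuity_pt_filterlim.
  apply (ex_derive_continuous (fun t => f (s + t * u) (p + t * v))).
  eexists; exact (Hder t ltac:(lra)).
- rewrite Rmin_left, Rmax_right in Ht by lra.
  rewrite !Rmult_0_l, !Rplus_0_r in Et; rewrite Et.
  assert (Hn : forall r, Rabs r <= Cmod (u, v) -> Rabs (t * r) < d).
  { intros r Hr; rewrite Rabs_mult, (Rabs_pos_eq t) by lra.
    eapply Rle_lt_trans; [| exact Hd].
    pose proof (Rabs_pos r); nra. }
  assert (E1 : Rabs (f1 (s + t * u) (p + t * v) - f1 s p) < eps).
  { apply H1; trivial; try (apply Hs; lra).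
    - replace (s + t * u - s) with (t * u) by ring; apply Hn; lra.
    - replace (p + t * v - p) with (t * v) by ring; apply Hn; lra. }
  assert (E2 : Rabs (f2 (s + t * u) (p + t * v) - f2 s p) < eps).
  { apply H2; trivial; try (apply Hs; lra).
    - replace (s + t * u - s) with (t * u) by ring; apply Hn; lra.
    - replace (p + t * v - p) with (t * v) by ring; apply Hn; lra. }
  set (g1 := f1 (s + t * u) (p + t * v)) in *.
  set (g2 := f2 (s + t * u) (p + t * v)) in *.
  replace (_ - _) with (dt * ((g1 - f1 s p) * u + (g2 - f2 s p) * v)) by ring.
  rewrite Rabs_mult, (Rabs_pos_eq dt) by trivial.
  apply Rmult_le_compat_l; trivial.
  eapply Rle_trans; [apply Rabs_triang |].
  rewrite !Rabs_mult.
  pose proof (Rabs_pos u); pose proof (Rabs_pos v).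
  pose proof (Rabs_pos (g1 - f1 s p)); pose proof (Rabs_pos (g2 - f2 s p)).
  nra.
Qed.

(** A stream function [u] has [u_s = B] and [u_p = - A]; this is [u s p - u s1 p]. *)
Definition stream (B : R -> R -> R) (s1 s p : R) : R := RInt (fun t => B t p) s1 s.

(** For the angular derivative, differentiate under the integral: [B2 = - A1] by incompressibility,
    and [- A1] integrates to [A s1 p - A s p]. The term [A s1 p] appears because the circle [s1]
    need not be a streamline. *)
Lemma stream_C1 s0 c A B A1 A2 B1 B2 (F : polar_flow s0 c A B A1 A2 B1 B2) s1 :
  s0 < s1 -> C1_above s0 (stream B s1) B (fun s p => A s1 p - A s p).
Proof.
intros Hs1 s p Hs.
assert (HcB : forall s p, s0 < s -> continuity_2d_pt B s p).
{ intros s' p' H; pose proof (pf_cont _ _ _ _ _ _ _ _ F s' p' ltac:(lra)) as H'.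
  exact (Forall_inv (Forall_inv_tail H')). }
assert (Hmin : forall s', s0 < s' -> s0 < Rmin s1 s') by (intros; now apply Rmin_glb_lt).
assert (Hint : forall s' p', s0 < s' -> ex_RInt (fun t => B t p') s1 s').
{ intros s' p' H; apply @ex_RInt_continuous; intros t Ht.
  apply (continuous_curry_1 B t p'), HcB; specialize (Hmin s' H); lra. }
apply differentiable_of_partials.
- assert (Hd : 0 < s - s0) by lra.
  exists (mkposreal _ Hd); simpl; intros s' p' Hs' _.
  apply Rabs_def2 in Hs'.
  apply (is_derive_RInt (fun t => B t p')  _ s1 s').
  + apply (filter_imp (fun t => s0 < t)).
    * intros t Ht; apply @RInt_correct, Hint; trivial.
    * apply (open_gt s0 s'); lra.
  + apply (continuous_curry_1 B s' p'), HcB; lra.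
- assert (HD : forall s' p', s0 < s' -> Derive (fun z => B s' z) p' = - A1 s' p').
  { intros s' p' H.
    pose proof (pf_div _ _ _ _ _ _ _ _ F s' p' H).
    replace (- A1 s' p') with (B2 s' p') by lra.
    apply is_derive_unique.
    exact (differentiable_is_derive_2 B s' p' _ _ (pf_B _ _ _ _ _ _ _ _ F s' p' H)). }
  assert (HcA1 : forall s p, s0 < s -> continuity_2d_pt A1 s p).
  { intros s' p' H; exact (Forall_inv (pf_cont1 _ _ _ _ _ _ _ _ F s' p' H)). }
  assert (E : RInt (fun t => Derive (fun u => B t u) p) s1 s = A s1 p - A s p).
  { apply is_RInt_unique.
    apply (is_RInt_ext (fun t => opp (A1 t p))).
    { intros t Ht; rewrite HD; [reflexivity |]; specialize (Hmin s Hs); lra. }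
    replace (A s1 p - A s p) with (opp (minus (A s p) (A s1 p))).
    2:{ unfold opp, minus, plus, opp; simpl; ring. }
    apply @is_RInt_opp.
    apply (is_RInt_derive (fun t => A t p) (fun t => A1 t p)).
    - intros t Ht; specialize (Hmin s Hs).
      apply (differentiable_is_derive_1 A t p _ (A2 t p)), (pf_A _ _ _ _ _ _ _ _ F); lra.
    - intros t Ht; specialize (Hmin s Hs).
      apply (continuous_curry_1 A1 t p), HcA1; lra. }
  rewrite <- E.
  apply (is_derive_RInt_param (fun q t => B t q) s1 s p).
  + apply filter_forall; intros q t Ht.
    specialize (Hmin s Hs).
    exists (B2 t q).
    apply (differentiable_is_derive_2 B t q (B1 t q)), (pf_B _ _ _ _ _ _ _ _ F); lra.
  + intros t Ht; specialize (Hmin s Hs).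
    apply (continuity_2d_pt_ext_loc (fun u v => - A1 v u)).
    * assert (Hd : 0 < t - s0) by lra.
      exists (mkposreal _ Hd); simpl; intros q t' _ Ht'.
      apply Rabs_def2 in Ht'; rewrite HD; lra.
    * apply continuity_2d_pt_opp.
      intros e; destruct (HcA1 t p ltac:(lra) e) as [d Hd].
      exists d; intros q t' Hq Ht'; now apply Hd.
  + apply filter_forall; intros q; now apply Hint.
- now apply HcB.
Qed.

(** * Uniform estimates for one Euler step *)

Definition vel (A B : R -> R -> R) (x : R * R) : C := (A (fst x) (snd x), B (fst x) (snd x)).

Definition jac (A1 A2 B1 B2 : R -> R -> R) (x h : R * R) : R * R :=
  (fst h * A1 (fst x) (snd x) + snd h * A2 (fst x) (snd x),
   fst h * B1 (fst x) (snd x) + snd h * B2 (fst x) (snd x)).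

Definition euler_step (A B : R -> R -> R) (dt : R) (x : R * R) : R * R :=
  let w := grad_dir (vel A B x) in (fst x + dt * fst w, snd x + dt * snd w).

Definition euler_step_diff (A B A1 A2 B1 B2 : R -> R -> R) (dt : R) (x h : R * R) : R * R :=
  let y := dgrad_dir (vel A B x) (jac A1 A2 B1 B2 x h) in
  (fst h + dt * fst y, snd h + dt * snd y).

Lemma Cmod_le_2 (z : C) (m : R) : Rabs (fst z) <= m -> Rabs (snd z) <= m -> Cmod z <= 2 * m.
Proof.
intros H1 H2; eapply Rle_trans; [apply Cmod_2Rmax |].
pose proof (Rabs_pos (fst z)).
apply Rmult_le_compat.
- apply sqrt_pos.
- eapply Rle_trans; [| apply Rmax_l]; trivial.
- pose proof (sqrt_sqrt 2 ltac:(lra)); pose proof (sqrt_pos 2); nra.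
- now apply Rmax_lub.
Qed.

(** On the strip from [s1] to [S] the bounds and moduli of continuity are uniform and
    [|V| >= c * exp s0], so one threshold for [dt] makes all Taylor errors small compared with
    [dt]. *)
Lemma step_exists s0 c A B A1 A2 B1 B2 (F : polar_flow s0 c A B A1 A2 B1 B2)
    s1 s2 S eps :
  s0 < s1 < s2 ->
  (forall s p, s0 <= s <= s2 -> 0 <= B s p) ->
  (forall p, Rabs (A s1 p) <= c * exp s0 / 2) ->
  0 < eps ->
  exists dt0, 0 < dt0 /\ forall dt, 0 < dt <= dt0 -> forall x, s1 <= fst x <= S ->
    s1 <= fst (euler_step A B dt x) <= fst x + dt / (c * exp s0) /\
    (forall h, Cmod (vel A B (euler_step A B dt x)) *
               Cmod (euler_step_diff A B A1 A2 B1 B2 dt x h)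
               <= (1 + eps * dt) * (Cmod (vel A B x) * Cmod h)) /\
    stream B s1 (fst x) (snd x) + dt / 4 <=
    stream B s1 (fst (euler_step A B dt x)) (snd (euler_step A B dt x)).
Proof.
intros Hs HB HA Heps.
pose proof (pf_c _ _ _ _ _ _ _ _ F) as Hc.
pose proof (exp_pos s0) as He.
set (c0 := c * exp s0) in *.
assert (Hc0 : 0 < c0) by (unfold c0; nra).
(* A step advances [s] by at most [dt / c0 <= 1], so its endpoint stays below [S + 1]. *)
pose proof (pf_strip _ _ _ _ _ _ _ _ F s1 (S + 1) ltac:(lra)) as Hst.
destruct (bounded_on_strip_exists_list _ _ _ Hst) as [M [HM Hb]].
(* The first bound keeps the Taylor defect within half of the expansion allowance [eps]; the second
   keeps the error in the stream growth below [dt / 4]. *)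
set (e := Rmin (eps * c0 ^ 2 / 16) (c0 / 16)).
assert (Hc2 : 0 < c0 ^ 2) by (apply pow_lt; lra).
assert (Hc4 : 0 < c0 ^ 4) by (apply pow_lt; lra).
assert (Hepos : 0 < e) by (apply Rmin_pos; nra).
assert (He1 : e <= eps * c0 ^ 2 / 16) by apply Rmin_l.
assert (He2 : e <= c0 / 16) by apply Rmin_r.
destruct (unif_on_strip_exists_list _ _ _ _ Hst Hepos) as [d [Hd Hu]].
clearbody e.
rewrite !Forall_cons_iff in Hb, Hu.
destruct Hb as (HbA & HbB & HbA1 & HbA2 & HbB1 & HbB2 & _).
destruct Hu as (HuA & HuB & HuA1 & HuA2 & HuB1 & HuB2 & _).
(* In order, the bounds ensure: a step shorter than 1, shorter than the modulus [d], and no longer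
   than the collar is wide; [|h + dt * Y| <= 2 |h|] together with the smallness required by
   [grad_dir_step]; a second-order term within the other half of the allowance. *)
assert (Hdt0 : exists dt0, 0 < dt0 /\ dt0 <= c0 /\ dt0 <= c0 * d / 2 /\
  dt0 <= c0 * (s2 - s1) /\ dt0 * (4 * M) <= c0 ^ 2 /\ dt0 * (32 * M ^ 2) <= eps * c0 ^ 4).
{ set (l1 := c0 ^ 2 / (4 * M + 1)); set (l2 := eps * c0 ^ 4 / (32 * M ^ 2 + 1)).
  assert (0 < l1) by (apply Rdiv_lt_0_compat; lra).
  assert (0 < l2) by (apply Rdiv_lt_0_compat; nra).
  assert (El1 : l1 * (4 * M + 1) = c0 ^ 2) by (unfold l1; field; lra).
  assert (El2 : l2 * (32 * M ^ 2 + 1) = eps * c0 ^ 4) by (unfold l2; field; nra).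
  exists (Rmin (Rmin c0 (c0 * d / 2)) (Rmin (c0 * (s2 - s1)) (Rmin l1 l2))).
  set (m := Rmin (Rmin c0 (c0 * d / 2)) (Rmin (c0 * (s2 - s1)) (Rmin l1 l2))).
  assert (0 < m) by (repeat apply Rmin_pos; nra).
  assert (m <= c0 /\ m <= c0 * d / 2 /\ m <= c0 * (s2 - s1) /\ m <= l1 /\ m <= l2).
  { unfold m; repeat split.
    - eapply Rle_trans; [apply Rmin_l |]; apply Rmin_l.
    - eapply Rle_trans; [apply Rmin_l |]; apply Rmin_r.
    - eapply Rle_trans; [apply Rmin_r |]; apply Rmin_l.
    - eapply Rle_trans; [apply Rmin_r |]; eapply Rle_trans; [apply Rmin_r |]; apply Rmin_l.
    - eapply Rle_trans; [apply Rmin_r |]; eapply Rle_trans; [apply Rmin_r |]; apply Rmin_r. }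
  assert (0 <= M ^ 2) by nra.
  clearbody m l1 l2.
  repeat split; try lra; nra. }
destruct Hdt0 as [dt0 [Hdt0 [D1 [D2 [D3 [D4 D5]]]]]].
exists dt0; split; trivial.
intros dt Hdt x Hx.
assert (T1 : dt <= c0) by lra.
assert (T2 : dt <= c0 * d / 2) by lra.
assert (T3 : dt <= c0 * (s2 - s1)) by lra.
assert (T4 : dt * (4 * M) <= c0 ^ 2) by nra.
assert (T5 : dt * (32 * M ^ 2) <= eps * c0 ^ 4).
{ assert (0 <= M ^ 2) by nra; nra. }
clear D1 D2 D3 D4 D5.
set (V := vel A B x).
assert (HV : c0 <= Cmod V).
{ eapply Rle_trans; [| apply (pf_lower _ _ _ _ _ _ _ _ F); lra].
  unfold c0; apply Rmult_le_compat_l; [lra |].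
  left; apply exp_increasing; lra. }
assert (HV0 : 0 < Cmod V) by lra.
set (W := grad_dir V).
assert (HW : Cmod W <= / c0).
{ unfold W; rewrite Cmod_grad_dir by trivial; apply Rinv_le_contravar; lra. }
pose proof (Cmod_ge_0 W) as HW0.
assert (Ic : c0 * / c0 = 1) by (field; lra).
set (ic := / c0) in *.
assert (Hic : 0 < ic) by (apply Rinv_0_lt_compat; lra).
pose proof (Rmax_Cmod W) as HWm.
pose proof (Rmax_l (Rabs (fst W)) (Rabs (snd W))) as HWl.
pose proof (Rmax_r (Rabs (fst W)) (Rabs (snd W))) as HWr.
assert (Hdc : dt / c0 = dt * ic) by reflexivity.
(* In the collar the step does not go inwards, as [B >= 0]; from beyond [s2] it is too short to
   cross the collar. *)
assert (Hstep1 : s1 <= fst x + dt * fst W).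
{ destruct (Rle_dec (fst x) s2) as [H|H].
  - assert (0 <= fst W).
    { unfold W, V, grad_dir, vel; simpl.
      apply Rmult_le_pos; [apply HB; lra |].
      left; apply Rinv_0_lt_compat.
      exact (sq_norm_pos V HV0). }
    nra.
  - assert (- ic <= fst W).
    { apply Rle_trans with (- Rabs (fst W)); [lra |].
      pose proof (Rle_abs (- fst W)); rewrite Rabs_Ropp in *; lra. }
    assert (dt * ic <= s2 - s1).
    { apply Rle_trans with (c0 * (s2 - s1) * ic); [nra |].
      replace (c0 * (s2 - s1) * ic) with (c0 * ic * (s2 - s1)) by ring; rewrite Ic; lra. }
    nra. }
assert (Hstep2 : fst x + dt * fst W <= fst x + dt * ic).
{ pose proof (Rle_abs (fst W)); nra. }
assert (Hdic : dt * ic <= 1) by nra.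
assert (Hdd : dt * Cmod W < d) by nra.
assert (Hin : s1 <= fst x + dt * fst W <= S + 1) by lra.
rewrite Hdc.
split; [split; trivial |].
set (x' := (fst x + dt * fst W, snd x + dt * snd W)).
change (euler_step A B dt x) with x'.
pose proof (pf_A _ _ _ _ _ _ _ _ F) as HdA.
pose proof (pf_B _ _ _ _ _ _ _ _ F) as HdB.
assert (HJ : forall h, Cmod (jac A1 A2 B1 B2 x h) <= 4 * M * Cmod h).
{ intros h; pose proof (Rmax_Cmod h) as H.
  pose proof (Rmax_l (Rabs (fst h)) (Rabs (snd h))).
  pose proof (Rmax_r (Rabs (fst h)) (Rabs (snd h))).
  assert (Hsum : forall f1 f2, Rabs f1 <= M -> Rabs f2 <= M ->
    Rabs (fst h * f1 + snd h * f2) <= 2 * M * Cmod h).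
  { intros f1 f2 K1 K2; eapply Rle_trans; [apply Rabs_triang |].
    rewrite !Rabs_mult.
    pose proof (Rabs_pos (fst h)); pose proof (Rabs_pos (snd h)).
    pose proof (Rabs_pos f1); pose proof (Rabs_pos f2).
    nra. }
  replace (4 * M * Cmod h) with (2 * (2 * M * Cmod h)) by ring.
  apply Cmod_le_2; simpl; apply Hsum; first [apply HbA1|apply HbA2|apply HbB1|apply HbB2]; lra. }
split.
- intros h.
  set (Y := dgrad_dir V (jac A1 A2 B1 B2 x h)).
  set (Z := jac A1 A2 B1 B2 x W).
  (* The Taylor remainder of the velocity per unit of [dt], so that the new velocity is exactly
     [V + dt * (Z + E)]. *)
  set (E := ((A (fst x') (snd x') - fst V - dt * fst Z) / dt,
             (B (fst x') (snd x') - snd V - dt * snd Z) / dt) : C).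
  assert (EV : vel A B x' = (V + dt * (Z + E))%C).
  { unfold vel, E.
    generalize (A (fst x') (snd x')) (B (fst x') (snd x')) V Z; intros a' b' V' Z'.
    unfold Cplus, Cmult, RtoC; simpl; f_equal; field; lra. }
  assert (ED : euler_step_diff A B A1 A2 B1 B2 dt x h = (h + dt * Y)%C).
  { unfold euler_step_diff; fold V; fold Y; generalize Y; intros Y'.
    unfold Cplus, Cmult, RtoC; simpl; f_equal; ring. }
  rewrite EV, ED.
  assert (HE : Cmod E <= 4 * e * ic).
  { replace (4 * e * ic) with (2 * (2 * e * ic)) by ring.
    assert (Hdiv : forall r, Rabs r <= dt * (2 * e * Cmod W) -> Rabs (r / dt) <= 2 * e * ic).
    { intros r Hr; unfold Rdiv; rewrite Rabs_mult, (Rabs_pos_eq (/ dt)).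
      2:{ left; apply Rinv_0_lt_compat; lra. }
      apply Rmult_le_reg_r with dt; [lra |].
      rewrite Rmult_assoc, Rinv_l, Rmult_1_r by lra.
      eapply Rle_trans; [exact Hr |].
      assert (e * Cmod W <= e * ic) by nra. nra. }
    apply Cmod_le_2; unfold E; simpl fst; simpl snd; apply Hdiv.
    - apply (segment_increment s0 s1 (S + 1) e d A A1 A2 x W dt); trivial; lra.
    - apply (segment_increment s0 s1 (S + 1) e d B B1 B2 x W dt); trivial; lra. }
  assert (HYh : Cmod Y <= 4 * M * ic ^ 2 * Cmod h).
  { unfold Y; rewrite Cmod_dgrad_dir by trivial.
    assert (/ Cmod V ^ 2 <= ic ^ 2).
    { unfold ic; rewrite <- pow_inv by lra; apply pow_incr; split.
      - left; now apply Rinv_0_lt_compat.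
      - apply Rinv_le_contravar; lra. }
    specialize (HJ h).
    assert (0 < / Cmod V ^ 2) by (apply Rinv_0_lt_compat, pow_lt; lra).
    pose proof (Cmod_ge_0 (jac A1 A2 B1 B2 x h)); pose proof (Cmod_ge_0 h).
    unfold Rdiv.
    apply Rle_trans with (4 * M * Cmod h * ic ^ 2); [| lra].
    apply Rmult_le_compat; lra. }
  assert (HZ : Cmod Z <= 4 * M * ic).
  { unfold Z; eapply Rle_trans; [apply HJ |]; nra. }
  eapply Rle_trans.
  { apply (grad_dir_step V (A1 (fst x) (snd x), B1 (fst x) (snd x))
      (A2 (fst x) (snd x), B2 (fst x) (snd x)) h E dt); simpl; trivial; try lra.
    - apply (pf_div _ _ _ _ _ _ _ _ F); lra.
    - apply (pf_curl _ _ _ _ _ _ _ _ F); lra.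
    - assert (Hk : Rabs (B1 (fst x) (snd x) - A2 (fst x) (snd x)) <= 2 * M).
      { unfold Rminus; eapply Rle_trans; [apply Rabs_triang |]; rewrite Rabs_Ropp.
        specialize (HbA2 (fst x) (snd x) ltac:(lra)).
        specialize (HbB1 (fst x) (snd x) ltac:(lra)). lra. }
      set (k := B1 (fst x) (snd x) - A2 (fst x) (snd x)) in *.
      assert (HV2 : c0 ^ 2 <= Cmod V ^ 2) by (apply pow_incr; lra).
      replace (Cmod V * (Cmod V * 1)) with (Cmod V ^ 2) by ring.
      set (Q := Cmod V ^ 2) in *.
      apply Rmult_le_reg_r with Q; [lra |].
      replace (dt * (k / Q) * Q) with (dt * k) by (field; lra).
      assert (- (2 * M) <= k).
      { pose proof (Rle_abs (- k)); rewrite Rabs_Ropp in *; lra. }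
      nra. }
  cbv zeta; fold W.
  change (fst W * fst (A1 (fst x) (snd x), B1 (fst x) (snd x)) + _, _) with Z.
  change (fst h * fst (A1 (fst x) (snd x), B1 (fst x) (snd x)) + _, _)
    with (jac A1 A2 B1 B2 x h).
  fold Y.
  pose proof (Cmod_ge_0 h) as Hh; pose proof (Cmod_ge_0 Y); pose proof (Cmod_ge_0 Z);
  pose proof (Cmod_ge_0 E).
  assert (HhY : Cmod (h + dt * Y) <= 2 * Cmod h).
  { eapply Rle_trans; [apply Cmod_triangle |].
    rewrite Cmod_mult, Cmod_R, Rabs_pos_eq by lra.
    assert (dt * (4 * M) * ic ^ 2 <= 1).
    { apply Rle_trans with (c0 ^ 2 * ic ^ 2); [| rewrite <- Rpow_mult_distr, Ic; lra].
      apply Rmult_le_compat_r; nra. }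
    assert (dt * Cmod Y <= dt * (4 * M * ic ^ 2 * Cmod h)) by (apply Rmult_le_compat_l; lra).
    nra. }
  (* The two errors of [grad_dir_step] each get half of [eps * c0 * |h|], which is at most
     [eps * |V| * |h|]. *)
  assert (G1 : Cmod E * Cmod (h + dt * Y) <= eps * c0 / 2 * Cmod h).
  { apply Rle_trans with (4 * e * ic * (2 * Cmod h)).
    { apply Rmult_le_compat; trivial; apply Cmod_ge_0. }
    assert (e * ic <= eps * c0 / 16).
    { apply Rle_trans with (eps * c0 ^ 2 / 16 * ic); [nra |].
      replace (eps * c0 ^ 2 / 16 * ic) with (eps * c0 / 16 * (c0 * ic)) by field.
      rewrite Ic; lra. }
    nra. }
  assert (G2 : dt * (Cmod Z * Cmod Y) <= eps * c0 / 2 * Cmod h).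
  { apply Rle_trans with (dt * (4 * M * ic * (4 * M * ic ^ 2 * Cmod h))).
    { apply Rmult_le_compat_l; [lra |]; apply Rmult_le_compat; trivial. }
    replace (dt * (4 * M * ic * (4 * M * ic ^ 2 * Cmod h)))
      with (dt * (32 * M ^ 2) * ic ^ 3 / 2 * Cmod h) by field.
    apply Rmult_le_compat_r; trivial.
    apply Rle_trans with (eps * c0 ^ 4 * ic ^ 3 / 2).
    { assert (0 < ic ^ 3) by (apply pow_lt; lra). nra. }
    replace (eps * c0 ^ 4 * ic ^ 3 / 2) with (eps * c0 / 2 * (c0 * ic) ^ 3) by field.
    rewrite Ic; lra. }
  assert (G3 : c0 * Cmod h <= Cmod V * Cmod h) by (apply Rmult_le_compat_r; lra).
  replace ((1 + eps * dt) * (Cmod V * Cmod h))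
    with (Cmod V * Cmod h + dt * (eps * (Cmod V * Cmod h))) by ring.
  apply Rplus_le_compat_l, Rmult_le_compat_l; [lra |].
  apply Rle_trans with (eps * (c0 * Cmod h)).
  { replace (eps * (c0 * Cmod h)) with (eps * c0 / 2 * Cmod h + eps * c0 / 2 * Cmod h) by field.
    apply Rplus_le_compat; [exact G1 | exact G2]. }
  apply Rmult_le_compat_l; lra.
- set (g := fun s p => A s1 p - A s p).
  assert (Hg : unif_on_strip s1 (S + 1) (2 * e) d g).
  { intros s p s' p' H1 H2 H3 H4; unfold g.
    pose proof (HuA s p s' p' H1 H2 H3 H4) as K1.
    pose proof (HuA s1 p s1 p' ltac:(lra) ltac:(lra)) as K2.
    rewrite Rminus_diag, Rabs_R0 in K2; specialize (K2 Hd H4).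
    apply Rabs_def2 in K1, K2; apply Rabs_def1; lra. }
  assert (HuB' : unif_on_strip s1 (S + 1) (2 * e) d B).
  { intros s p s' p' H1 H2 H3 H4.
    pose proof (HuB s p s' p' H1 H2 H3 H4); lra. }
  pose proof (segment_increment s0 s1 (S + 1) (2 * e) d (stream B s1) B g x W dt
    (stream_C1 _ _ _ _ _ _ _ _ F s1 ltac:(lra)) ltac:(lra) ltac:(lra) HuB' Hg
    ltac:(lra) Hin Hdd) as Hinc.
  apply Rabs_le_between in Hinc.
  (* Since [W . (B, - A) = 1], the slope is 1 plus [snd W * A s1]; the choice of the starting circle
     bounds that term by [(1 / c0) * (c0 / 2)]. *)
  assert (Hgr : fst W * B (fst x) (snd x) + snd W * g (fst x) (snd x) >= / 2).
  { assert (Eq : fst W * B (fst x) (snd x) + snd W * g (fst x) (snd x)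
      = 1 + snd W * A s1 (snd x)).
    { pose proof (sq_norm_pos V HV0) as HQ.
      unfold g, W, grad_dir; unfold V, vel in *; simpl in *; field; lra. }
    rewrite Eq.
    assert (Rabs (snd W * A s1 (snd x)) <= / 2).
    { rewrite Rabs_mult.
      specialize (HA (snd x)).
      apply Rle_trans with (ic * (c0 / 2)).
      - apply Rmult_le_compat; try apply Rabs_pos; lra.
      - replace (ic * (c0 / 2)) with (c0 * ic / 2) by field; lra. }
    apply Rabs_le_between in H; lra. }
  assert (HeW : e * Cmod W <= / 16) by nra.
  change (fst x') with (fst x + dt * fst W).
  change (snd x') with (snd x + dt * snd W).
  set (G := fst W * B (fst x) (snd x) + snd W * g (fst x) (snd x)) in *.
  assert (dt * / 2 <= dt * G) by (apply Rmult_le_compat_l; lra).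
  assert (dt * (2 * (2 * e) * Cmod W) <= dt * / 4) by (apply Rmult_le_compat_l; lra).
  lra.
Qed.

(** * The Euler curves *)

Fixpoint euler_curve (A B : R -> R -> R) (s1 dt : R) (k : nat) (th : R) : R * R :=
  match k with
  | O => (s1, th)
  | S k => euler_step A B dt (euler_curve A B s1 dt k th)
  end.

Fixpoint euler_curve_diff (A B A1 A2 B1 B2 : R -> R -> R) (s1 dt : R) (k : nat) (th : R)
    : R * R :=
  match k with
  | O => (0, 1)
  | S k => euler_step_diff A B A1 A2 B1 B2 dt (euler_curve A B s1 dt k th)
             (euler_curve_diff A B A1 A2 B1 B2 s1 dt k th)
  end.

Definition is_derive_pair (f : R -> R * R) (x : R) (l : R * R) : Prop :=
  is_derive (fun t => fst (f t)) x (fst l) /\ is_derive (fun t => snd (f t)) x (snd l).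

Lemma is_derive_euler_step s0 c A B A1 A2 B1 B2 (F : polar_flow s0 c A B A1 A2 B1 B2)
    (dt : R) (X : R -> R * R) (x : R) (l : R * R) :
  s0 < fst (X x) -> is_derive_pair X x l ->
  is_derive_pair (fun t => euler_step A B dt (X t)) x
    (euler_step_diff A B A1 A2 B1 B2 dt (X x) l).
Proof.
intros Hx [H1 H2].
assert (HV : 0 < Cmod (A (fst (X x)) (snd (X x)), B (fst (X x)) (snd (X x)))).
{ eapply Rlt_le_trans; [| apply (pf_lower _ _ _ _ _ _ _ _ F _ _ Hx)].
  apply Rmult_lt_0_compat; [apply (pf_c _ _ _ _ _ _ _ _ F) | apply exp_pos]. }
pose proof (is_derive_comp_2d A _ _ x _ _ _ _
  (pf_A _ _ _ _ _ _ _ _ F _ (snd (X x)) Hx) H1 H2) as HA.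
pose proof (is_derive_comp_2d B _ _ x _ _ _ _
  (pf_B _ _ _ _ _ _ _ _ F _ (snd (X x)) Hx) H1 H2) as HB.
destruct (is_derive_grad_dir _ _ x _ _ HV HA HB) as [G1 G2].
assert (EJ : jac A1 A2 B1 B2 (X x) l =
  (A1 (fst (X x)) (snd (X x)) * fst l + A2 (fst (X x)) (snd (X x)) * snd l,
   B1 (fst (X x)) (snd (X x)) * fst l + B2 (fst (X x)) (snd (X x)) * snd l)).
{ unfold jac; f_equal; ring. }
rewrite <- EJ in G1, G2.
split.
- apply (is_derive_plus (fun t => fst (X t)) _ x _ _ H1).
  apply (is_derive_scal _ x dt _ G1).
- apply (is_derive_plus (fun t => snd (X t)) _ x _ _ H2).
  apply (is_derive_scal _ x dt _ G2).
Qed.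

Lemma euler_step_shift (A B : R -> R -> R) (dt : R) (x : R * R) :
  periodic A -> periodic B ->
  euler_step A B dt (fst x, snd x + 2 * PI) =
  (fst (euler_step A B dt x), snd (euler_step A B dt x) + 2 * PI).
Proof.
intros HA HB.
assert (E : vel A B (fst x, snd x + 2 * PI) = vel A B x).
{ unfold vel; simpl; rewrite HA, HB; reflexivity. }
unfold euler_step; rewrite E; simpl; f_equal; ring.
Qed.

(** The field is periodic, so each image of the starting circle still winds exactly once around the
    hole. *)
Lemma euler_curve_shift (A B : R -> R -> R) (s1 dt : R) (k : nat) (th : R) :
  periodic A -> periodic B ->
  euler_curve A B s1 dt k (th + 2 * PI) =
  (fst (euler_curve A B s1 dt k th), snd (euler_curve A B s1 dt k th) + 2 * PI).
Proof.
intros HA HB; induction k as [|k IH]; simpl.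
- reflexivity.
- rewrite IH; now apply euler_step_shift.
Qed.

Lemma pow_le_exp (x : R) (n : nat) : 0 <= x -> (1 + x) ^ n <= exp (INR n * x).
Proof.
intros Hx; induction n as [|n IH].
- simpl; rewrite Rmult_0_l, exp_0; lra.
- rewrite S_INR, Rmult_plus_distr_r, Rmult_1_l, exp_plus; simpl.
  rewrite Rmult_comm; apply Rmult_le_compat; trivial; try lra.
  + apply pow_le; lra.
  + apply exp_ineq1_le.
Qed.

(* A loop around the cylinder on which [c e^s |X'| <= m], i.e. one of bounded
   Euclidean length, stays in a bounded region: [e^s <= m / c] where the angle
   moves at speed 1. *)
Lemma loop_bound (c m : R) (X D : R -> R * R) :
  0 < c ->
  (forall th, is_derive_pair X th (D th)) ->
  snd (X (2 * PI)) = snd (X 0) + 2 * PI ->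
  (forall th, c * exp (fst (X th)) * Cmod (D th) <= m) ->
  exp (fst (X 0)) <= (1 + 2 * PI) * (m / c).
Proof.
intros Hc HD Hper Hm.
pose proof PI_RGT_0 as Hpi.
assert (Hm' : forall th, exp (fst (X th)) * Cmod (D th) <= m / c).
{ intros th; apply Rmult_le_reg_l with c; [lra |].
  replace (c * (m / c)) with m by (field; lra).
  rewrite <- Rmult_assoc; apply Hm. }
(* The angle has mean speed 1 over the period, hence speed 1 at some [t]. *)
destruct (MVT_gen (fun t => snd (X t)) 0 (2 * PI) (fun t => snd (D t))) as [t [Ht Et]].
{ intros t _; apply HD. }
{ intros t _; apply continuity_pt_filterlim.
  apply (ex_derive_continuous (fun t => snd (X t))); eexists; apply (proj2 (HD t)). }
rewrite Rmin_left, Rmax_right in Ht by lra.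
assert (ED : snd (D t) = 1) by (rewrite Hper in Et; nra).
assert (Hexp : forall th, is_derive (fun t => exp (fst (X t))) th
  (exp (fst (X th)) * fst (D th))).
{ intros th; destruct (HD th) as [H _].
  rewrite Rmult_comm.
  apply (is_derive_comp exp (fun t => fst (X t))); trivial.
  apply is_derive_exp. }
(* Between [t] and 0 the radius [e^s] changes at rate at most [m / c], over a parameter length of at
   most [2 * PI]. *)
destruct (MVT_gen (fun t => exp (fst (X t))) 0 t (fun th => exp (fst (X th)) * fst (D th)))
  as [t' [_ Et']].
{ intros r _; apply Hexp. }
{ intros r _; apply continuity_pt_filterlim.
  apply (ex_derive_continuous (fun t => exp (fst (X t)))); eexists; apply Hexp. }
pose proof (Hm' t) as K1; pose proof (Hm' t') as K2.
pose proof (exp_pos (fst (X t))) as P1; pose proof (exp_pos (fst (X t'))) as P2.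
pose proof (Rmax_Cmod (D t)) as R1; pose proof (Rmax_Cmod (D t')) as R2.
pose proof (Rmax_r (Rabs (fst (D t))) (Rabs (snd (D t)))) as Q1.
pose proof (Rmax_l (Rabs (fst (D t'))) (Rabs (snd (D t')))) as Q2.
rewrite ED, Rabs_R1 in *.
assert (L1 : exp (fst (X t)) <= m / c).
{ eapply Rle_trans; [| exact K1]. rewrite <- (Rmult_1_r (exp _)) at 1.
  apply Rmult_le_compat_l; lra. }
assert (L2 : - (m / c) <= exp (fst (X t')) * fst (D t')).
{ pose proof (Rle_abs (- fst (D t'))) as H; rewrite Rabs_Ropp in H.
  assert (exp (fst (X t')) * (- fst (D t')) <= m / c).
  { eapply Rle_trans; [| exact K2]; apply Rmult_le_compat_l; lra. }
  lra. }
nra.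
Qed.

(** The order of choices avoids circularity: the length bound fixes the region [s <= smax], this
    fixes the bound [U] of the stream function, then come the time [T], the tolerance [eps], and
    last the step [dt]. *)
Lemma no_polar_flow s0 c A B A1 A2 B1 B2 : ~ polar_flow s0 c A B A1 A2 B1 B2.
Proof.
intros F.
destruct (start_circle _ _ _ _ _ _ _ _ F) as [s1 [s2 [Hs [HB HA]]]].
pose proof (pf_c _ _ _ _ _ _ _ _ F) as Hc.
pose proof (exp_pos s0) as He.
pose proof PI_RGT_0 as Hpi.
set (c0 := c * exp s0) in *.
assert (Hc0 : 0 < c0) by (unfold c0; nra).
assert (HM0 : exists M0, 0 < M0 /\ forall p, Cmod (vel A B (s1, p)) <= M0).
{ pose proof (pf_strip _ _ _ _ _ _ _ _ F s1 s1 ltac:(lra)) as Hst.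
  destruct (bounded_on_strip_exists_list _ _ _ Hst) as [M [HM Hb]].
  rewrite !Forall_cons_iff in Hb; destruct Hb as (HbA & HbB & _).
  exists (2 * M + 1); split; [lra |].
  intros p; apply Rle_trans with (2 * M); [| lra].
  apply Cmod_le_2; simpl; [apply HbA | apply HbB]; lra. }
destruct HM0 as [M0 [HM0 Hstart]].
(* The bound of [loop_bound] for [m = 2 * M0]: the initial density [M0] is going to grow at most by
   a factor 2. *)
set (Emax := (1 + 2 * PI) * (2 * M0 / c)).
assert (HEmax : 0 < Emax).
{ apply Rmult_lt_0_compat; [lra |]; apply Rdiv_lt_0_compat; lra. }
set (smax := Rmax s1 (ln Emax)).
assert (Hsmax : s1 <= smax) by apply Rmax_l.
assert (HU : exists U, 0 <= U /\ forall s p, s1 <= s <= smax -> stream B s1 s p <= U).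
{ pose proof (pf_strip _ _ _ _ _ _ _ _ F s1 smax ltac:(lra)) as Hst.
  destruct (bounded_on_strip_exists_list _ _ _ Hst) as [M [HM Hb]].
  rewrite !Forall_cons_iff in Hb; destruct Hb as (_ & HbB & _).
  exists (M * (smax - s1)); split; [nra |].
  intros s p Hsp.
  assert (Hd : forall t, s1 <= t -> is_derive (fun t => stream B s1 t p) t (B t p)).
  { intros t Ht.
    exact (differentiable_is_derive_1 _ t p _ _
      (stream_C1 _ _ _ _ _ _ _ _ F s1 ltac:(lra) t p ltac:(lra))). }
  destruct (MVT_gen (fun t => stream B s1 t p) s1 s (fun t => B t p)) as [t [Ht Et]].
  { intros t; rewrite Rmin_left by lra; intros Ht; apply Hd; lra. }
  { intros t; rewrite Rmin_left by lra; intros Ht; apply continuity_pt_filterlim.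
    apply (ex_derive_continuous (fun t => stream B s1 t p)); eexists; apply Hd; lra. }
  rewrite Rmin_left, Rmax_right in Ht by lra.
  assert (E0 : stream B s1 s1 p = 0) by apply @RInt_point.
  rewrite E0, Rminus_0_r in Et; rewrite Et.
  specialize (HbB t p ltac:(lra)).
  pose proof (Rle_abs (B t p)); nra. }
destruct HU as [U [HU Hstream]].
(* Growth at rate [1 / 4] for the time [T] brings the stream function to [U + 1]. *)
set (T := 4 * U + 4).
assert (HT : 0 < T) by (unfold T; lra).
(* With [K * dt = T], the accumulated factor [(1 + eps * dt) ^ K] is at most [exp (eps * T) = 2]. *)
set (eps := ln 2 / T).
assert (Hln2 : 0 < ln 2) by (rewrite <- ln_1; apply ln_increasing; lra).
assert (Heps : 0 < eps) by (apply Rdiv_lt_0_compat; lra).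
(* As [s] grows at speed at most [1 / c0], no curve leaves this strip before the time [T], whatever
   the step length. *)
destruct (step_exists _ _ _ _ _ _ _ _ F s1 s2 (s1 + T / c0) eps Hs HB HA Heps)
  as [dt0 [Hdt0 Hstep]].
destruct (INR_unbounded (T / dt0)) as [K HK].
assert (HTd : 0 < T / dt0) by (apply Rdiv_lt_0_compat; lra).
set (dt := T / INR K).
assert (Hdt : 0 < dt) by (apply Rdiv_lt_0_compat; lra).
assert (HKdt : INR K * dt = T) by (unfold dt; field; lra).
assert (Hdt' : dt <= dt0).
{ apply Rmult_le_reg_l with (INR K); [lra |]; rewrite HKdt.
  apply Rmult_lt_compat_r with (r := dt0) in HK; [| lra].
  replace (T / dt0 * dt0) with T in HK by (field; lra); lra. }
specialize (Hstep dt ltac:(lra)).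
set (X := euler_curve A B s1 dt); set (D := euler_curve_diff A B A1 A2 B1 B2 s1 dt).
assert (Hind : forall k, (k <= K)%nat -> forall th,
  s1 <= fst (X k th) <= s1 + INR k * dt / c0 /\
  is_derive_pair (X k) th (D k th) /\
  Cmod (vel A B (X k th)) * Cmod (D k th) <= (1 + eps * dt) ^ k * M0 /\
  INR k * dt / 4 <= stream B s1 (fst (X k th)) (snd (X k th))).
{ induction k as [|k IH]; intros Hk th.
  - split; [simpl; lra | split; [| split]].
    + split; simpl.
      * apply @is_derive_const.
      * apply @is_derive_id.
    + change (Cmod (vel A B (s1, th)) * Cmod Ci <= 1 * M0).
      rewrite Cmod_Ci; specialize (Hstart th); lra.
    + simpl; unfold stream; rewrite RInt_point; unfold zero; simpl; lra.
  - specialize (IH ltac:(lia) th); destruct IH as (I1 & I2 & I3 & I4).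
    assert (Hkc : INR k * dt / c0 <= T / c0).
    { apply Rmult_le_compat_r; [left; now apply Rinv_0_lt_compat |].
      rewrite <- HKdt; apply Rmult_le_compat_r; [lra |]; apply le_INR; lia. }
    destruct (Hstep (X k th) ltac:(lra)) as (J1 & J2 & J3).
    fold c0 in J1; specialize (J2 (D k th)).
    rewrite S_INR.
    change (X (S k) th) with (euler_step A B dt (X k th)).
    change (D (S k) th) with (euler_step_diff A B A1 A2 B1 B2 dt (X k th) (D k th)).
    split; [| split; [| split]].
    + replace ((INR k + 1) * dt / c0) with (INR k * dt / c0 + dt / c0) by (field; lra).
      lra.
    + apply (is_derive_euler_step _ _ _ _ _ _ _ _ F dt (X k) th (D k th)); trivial; lra.
    + eapply Rle_trans; [exact J2 |].
      simpl pow; rewrite Rmult_assoc; apply Rmult_le_compat_l; trivial; nra.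
    + lra. }
specialize (Hind K (Nat.le_refl K)).
assert (Hpow : (1 + eps * dt) ^ K * M0 <= 2 * M0).
{ apply Rmult_le_compat_r; [lra |].
  eapply Rle_trans; [apply pow_le_exp; nra |].
  replace (INR K * (eps * dt)) with (eps * (INR K * dt)) by ring.
  rewrite HKdt; unfold eps; replace (ln 2 / T * T) with (ln 2) by (field; lra).
  rewrite exp_ln; lra. }
pose proof (pf_per _ _ _ _ _ _ _ _ F) as Hper.
rewrite !Forall_cons_iff in Hper; destruct Hper as (HpA & HpB & _).
assert (HE : exp (fst (X K 0)) <= Emax).
{ apply (loop_bound c (2 * M0) (X K) (D K)); trivial.
  - intros th; apply Hind.
  - pose proof (euler_curve_shift A B s1 dt K 0 HpA HpB) as H.
    rewrite Rplus_0_l in H; unfold X; rewrite H; reflexivity.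
  - intros th; destruct (Hind th) as (I1 & _ & I3 & _).
    eapply Rle_trans; [| eapply Rle_trans; [exact I3 | exact Hpow]].
    apply Rmult_le_compat_r; [apply Cmod_ge_0 |].
    apply (pf_lower _ _ _ _ _ _ _ _ F); lra. }
destruct (Hind 0) as (I1 & _ & _ & I4).
assert (Hs' : fst (X K 0) <= ln Emax).
{ rewrite <- (ln_exp (fst (X K 0))); apply ln_le; trivial; apply exp_pos. }
specialize (Hstream (fst (X K 0)) (snd (X K 0))).
rewrite HKdt in I4.
pose proof (Rmax_r s1 (ln Emax)); fold smax in H.
specialize (Hstream ltac:(lra)).
unfold T in I4; lra.
Qed.

(** * Reduction of the exterior domain to a half-plane *)

(** The partials are carried as explicit functions, so that the reversed flow fits in with negated
    partials. *)
Definition C1_partials (a : R) (f f1 f2 : R * R -> R) : Prop :=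
  continuous_on (closure (Omega a)) f /\
  continuous_on (Omega a) f1 /\ continuous_on (Omega a) f2 /\
  forall x y, Omega a (x, y) ->
    is_derive (fun t => f (t, y)) x (f1 (x, y)) /\
    is_derive (fun t => f (x, t)) y (f2 (x, y)).

Lemma C1_partials_opp (a : R) (f f1 f2 : R * R -> R) :
  C1_partials a f f1 f2 ->
  C1_partials a (fun x => - f x) (fun x => - f1 x) (fun x => - f2 x).
Proof.
assert (Hopp : forall D (g : R * R -> R), continuous_on D g -> continuous_on D (fun x => - g x)).
{ intros D g Hg x Hx; eapply filterlim_comp; [now apply Hg |].
  apply (filterlim_opp (g x)). }
intros (H & H1 & H2 & H3); split; [| split; [| split]]; try now apply Hopp.
intros x y Hx; destruct (H3 x y Hx); split.
- now apply (is_derive_opp (fun t => f (t, y))).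
- now apply (is_derive_opp (fun t => f (x, t))).
Qed.

Lemma Ck_closure_C1 (a : R) (k : nat) (f : R * R -> R) :
  Ck_closure (Omega a) (S k) f -> C1_partials a f (d1 f) (d2 f).
Proof.
intros [[_ [Hex [H1 H2]]] [Hc _]].
split; [exact Hc | split; [| split]].
- destruct k; apply H1.
- destruct k; apply H2.
- intros x y Hx; destruct (Hex _ Hx) as [E1 E2]; split.
  + apply (Derive_correct (fun t => f (t, y))), E1.
  + apply (Derive_correct (fun t => f (x, t))), E2.
Qed.

(** Continuity relative to [D] becomes ordinary continuity of the composite, because the inner map
    takes nearby points into [D]. *)
Lemma continuity_2d_comp_on (D : R * R -> Prop) (F : R * R -> R) (u v : R -> R -> R) (s p : R) :
  continuous_on D F ->
  locally_2d (fun s p => D (u s p, v s p)) s p ->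
  continuity_2d_pt u s p -> continuity_2d_pt v s p ->
  continuity_2d_pt (fun s p => F (u s p, v s p)) s p.
Proof.
intros HF HD Hu Hv.
apply continuity_2d_pt_filterlim in Hu, Hv.
apply continuity_2d_pt_filterlim.
apply (filterlim_comp _ _ _ (fun z : R * R => (u (fst z) (snd z), v (fst z) (snd z))) F
  _ (within D (locally (u s p, v s p)))).
2:{ apply HF, (locally_2d_singleton _ _ _ HD). }
intros P HP; unfold within in HP.
apply locally_2d_locally in HD.
pose proof (filterlim_pair _ _ Hu Hv) as Hp.
assert (HP' : filter_prod (locally (u s p)) (locally (v s p)) (fun x => D x -> P x)).
{ destruct HP as [e He].
  exists (ball (u s p) e) (ball (v s p) e); try apply locally_ball.
  intros x y Hx Hy; apply He; now split. }
specialize (Hp _ HP').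
unfold filtermap in *.
apply (filter_imp (fun z : R * R =>
  (D (u (fst z) (snd z), v (fst z) (snd z)) -> P (u (fst z) (snd z), v (fst z) (snd z))) /\
  D (u (fst z) (snd z), v (fst z) (snd z)))).
- intros z [K1 K2]; auto.
- now apply filter_and.
Qed.

Lemma Omega_open (a x y : R) : Omega a (x, y) -> locally_2d (fun u v => Omega a (u, v)) x y.
Proof.
intros H; unfold Omega in *.
assert (Hc : continuity_2d_pt (fun u v => enorm (u, v)) x y).
{ unfold enorm; simpl fst; simpl snd.
  apply (continuity_1d_2d_pt_comp sqrt).
  - apply continuity_pt_sqrt; nra.
  - apply continuity_2d_pt_plus;
      apply (continuity_1d_2d_pt_comp (fun t => t ^ 2));
      try (apply derivable_continuous_pt, derivable_pt_pow);
      first [apply continuity_2d_pt_id1 | apply continuity_2d_pt_id2]. }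
assert (He : 0 < enorm (x, y) - a) by lra.
destruct (Hc (mkposreal _ He)) as [d Hd].
exists d; intros u v Hu Hv; specialize (Hd u v Hu Hv); simpl in Hd.
apply Rabs_def2 in Hd; lra.
Qed.

Lemma closure_Omega (a : R) (x : R * R) : 0 < a -> a <= enorm x -> closure (Omega a) x.
Proof.
intros Ha Hx P [e He].
destruct x as [x y].
(* The approximating point is the radial dilation by [1 + t]; with [t = e / m] both coordinates move
   by less than [e]. *)
set (m := Rabs x + Rabs y + 1).
pose proof (Rabs_pos x); pose proof (Rabs_pos y); pose proof (cond_pos e).
assert (Hm : 0 < m) by (unfold m; lra).
set (t := e / m).
assert (Ht : 0 < t) by (apply Rdiv_lt_0_compat; lra).
assert (Etm : t * m = e) by (unfold t; field; lra).
unfold m in Etm.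
exists ((1 + t) * x, (1 + t) * y); split.
- apply He; split; unfold ball; simpl; unfold AbsRing_ball, abs, minus, plus, opp; simpl.
  + replace ((1 + t) * x + - x) with (t * x) by ring.
    rewrite Rabs_mult, (Rabs_pos_eq t) by lra; nra.
  + replace ((1 + t) * y + - y) with (t * y) by ring.
    rewrite Rabs_mult, (Rabs_pos_eq t) by lra; nra.
- unfold Omega.
  assert (E : enorm ((1 + t) * x, (1 + t) * y) = (1 + t) * enorm (x, y)).
  { unfold enorm; simpl fst; simpl snd.
    replace (((1 + t) * x) ^ 2 + ((1 + t) * y) ^ 2) with ((1 + t) ^ 2 * (x ^ 2 + y ^ 2)) by ring.
    rewrite sqrt_mult_alt by nra; rewrite sqrt_pow2 by lra; reflexivity. }
  rewrite E; nra.
Qed.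

(** * Logarithmic polar coordinates and the transformed velocity *)

Definition px (s p : R) : R := exp s * cos p.
Definition py (s p : R) : R := exp s * sin p.

Lemma px_py_sq (s p : R) : px s p ^ 2 + py s p ^ 2 = exp s ^ 2.
Proof.
unfold px, py.
pose proof (sin2_cos2 p) as H; unfold Rsqr in H.
replace ((exp s * cos p) ^ 2 + (exp s * sin p) ^ 2)
  with (exp s ^ 2 * (sin p * sin p + cos p * cos p)) by ring.
rewrite H; ring.
Qed.

Lemma enorm_polar (s p : R) : enorm (px s p, py s p) = exp s.
Proof.
unfold enorm; simpl fst; simpl snd; rewrite px_py_sq.
apply sqrt_pow2; left; apply exp_pos.
Qed.

Lemma px_periodic : periodic px.
Proof.
intros s p; unfold px; now rewrite cos_plus, cos_2PI, sin_2PI, Rmult_1_r, Rmult_0_r, Rminus_0_r.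
Qed.

Lemma py_periodic : periodic py.
Proof.
intros s p; unfold py; now rewrite sin_plus, cos_2PI, sin_2PI, Rmult_1_r, Rmult_0_r, Rplus_0_r.
Qed.

Lemma continuity_2d_px (s p : R) : continuity_2d_pt px s p.
Proof.
apply continuity_2d_pt_mult.
- apply (continuity_1d_2d_pt_comp exp); [| apply continuity_2d_pt_id1].
  apply derivable_continuous_pt, derivable_pt_exp.
- apply (continuity_1d_2d_pt_comp cos); [apply continuity_cos | apply continuity_2d_pt_id2].
Qed.

Lemma continuity_2d_py (s p : R) : continuity_2d_pt py s p.
Proof.
apply continuity_2d_pt_mult.
- apply (continuity_1d_2d_pt_comp exp); [| apply continuity_2d_pt_id1].
  apply derivable_continuous_pt, derivable_pt_exp.
- apply (continuity_1d_2d_pt_comp sin); [apply continuity_sin | apply continuity_2d_pt_id2].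
Qed.

Lemma is_derive_px_py (s p : R) :
  is_derive (fun t => px t p) s (px s p) /\ is_derive (fun t => py t p) s (py s p) /\
  is_derive (px s) p (- py s p) /\ is_derive (py s) p (px s p).
Proof. unfold px, py; split; [| split; [| split]]; auto_derive; trivial; ring. Qed.

Lemma is_derive_pairing (u v f g : R -> R) (x du dv df dg : R) :
  is_derive u x du -> is_derive v x dv -> is_derive f x df -> is_derive g x dg ->
  is_derive (fun t => u t * f t + v t * g t) x
    (du * f x + u x * df + (dv * g x + v x * dg)).
Proof.
intros Hu Hv Hf Hg.
apply (is_derive_plus (fun t => u t * f t) (fun t => v t * g t)).
- apply (is_derive_mult u f x du df Hu Hf); intros; apply Rmult_comm.
- apply (is_derive_mult v g x dv dg Hv Hg); intros; apply Rmult_comm.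
Qed.

(** For a velocity [(f, g)] this is [A = e^s v.e_r]; applied to [g] and [- f] it is
    [B = e^s v.e_theta]. *)
Definition polar_pairing (f g : R * R -> R) (s p : R) : R :=
  px s p * f (px s p, py s p) + py s p * g (px s p, py s p).

Definition polar_pairing_s (f f1 f2 g g1 g2 : R * R -> R) (s p : R) : R :=
  let x := (px s p, py s p) in
  px s p * f x + px s p * (f1 x * px s p + f2 x * py s p) +
  (py s p * g x + py s p * (g1 x * px s p + g2 x * py s p)).

Definition polar_pairing_p (f f1 f2 g g1 g2 : R * R -> R) (s p : R) : R :=
  let x := (px s p, py s p) in
  - py s p * f x + px s p * (f1 x * - py s p + f2 x * px s p) +
  (px s p * g x + py s p * (g1 x * - py s p + g2 x * px s p)).

Lemma Omega_polar (a s p : R) : 0 < a -> ln a < s -> Omega a (px s p, py s p).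
Proof.
intros Ha Hs; unfold Omega; rewrite enorm_polar.
rewrite <- (exp_ln a Ha); now apply exp_increasing.
Qed.

Lemma Omega_polar_locally (a s p : R) :
  0 < a -> ln a < s -> locally_2d (fun s p => Omega a (px s p, py s p)) s p.
Proof.
intros Ha Hs.
assert (Hd : 0 < s - ln a) by lra.
exists (mkposreal _ Hd); simpl; intros u v Hu _.
apply Omega_polar; trivial; apply Rabs_def2 in Hu; lra.
Qed.

Lemma C1_partials_differentiable (a : R) (f f1 f2 : R * R -> R) (x y : R) :
  C1_partials a f f1 f2 -> Omega a (x, y) ->
  differentiable_pt_lim (fun x y => f (x, y)) x y (f1 (x, y)) (f2 (x, y)).
Proof.
intros (_ & H1 & _ & H) Hx.
apply (differentiable_of_partials _ (fun x y => f1 (x, y))).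
- eapply locally_2d_impl; [| exact (Omega_open a x y Hx)].
  apply locally_2d_forall; intros u v Huv; now apply H.
- now apply H.
- apply (continuity_2d_comp_on (Omega a) f1 (fun x _ => x) (fun _ y => y)); trivial.
  + now apply Omega_open.
  + apply continuity_2d_pt_id1.
  + apply continuity_2d_pt_id2.
Qed.

Ltac cont2d :=
  repeat first [ apply continuity_2d_px | apply continuity_2d_py | apply continuity_2d_pt_plus
               | apply continuity_2d_pt_mult | apply continuity_2d_pt_opp ].

Lemma C1_partials_continuity_polar (a : R) (f f1 f2 : R * R -> R) (s p : R) :
  0 < a -> ln a < s -> C1_partials a f f1 f2 ->
  Forall (fun h => continuity_2d_pt (fun s p => h (px s p, py s p)) s p) (f :: f1 :: f2 :: nil).
Proof.
intros Ha Hs (H & H1 & H2 & _).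
pose proof (Omega_polar_locally a s p Ha Hs) as Hl.
repeat constructor.
- apply (continuity_2d_comp_on (closure (Omega a))); trivial.
  + eapply locally_2d_impl; [| exact Hl].
    apply locally_2d_forall; intros u v Huv; apply closure_Omega; trivial.
    left; exact Huv.
  + apply continuity_2d_px.
  + apply continuity_2d_py.
- apply (continuity_2d_comp_on (Omega a)); trivial; [apply continuity_2d_px | apply continuity_2d_py].
- apply (continuity_2d_comp_on (Omega a)); trivial; [apply continuity_2d_px | apply continuity_2d_py].
Qed.

Lemma polar_pairing_C1 (a : R) (f f1 f2 g g1 g2 : R * R -> R) (s p : R) :
  0 < a -> C1_partials a f f1 f2 -> C1_partials a g g1 g2 -> ln a < s ->
  differentiable_pt_lim (polar_pairing f g) s p
    (polar_pairing_s f f1 f2 g g1 g2 s p) (polar_pairing_p f f1 f2 g g1 g2 s p) /\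
  continuity_2d_pt (polar_pairing_s f f1 f2 g g1 g2) s p /\
  continuity_2d_pt (polar_pairing_p f f1 f2 g g1 g2) s p.
Proof.
intros Ha Hf Hg Hs.
assert (Hc : continuity_2d_pt (polar_pairing_s f f1 f2 g g1 g2) s p /\
             continuity_2d_pt (polar_pairing_p f f1 f2 g g1 g2) s p).
{ pose proof (C1_partials_continuity_polar a f f1 f2 s p Ha Hs Hf) as Kf.
  pose proof (C1_partials_continuity_polar a g g1 g2 s p Ha Hs Hg) as Kg.
  rewrite !Forall_cons_iff in Kf, Kg.
  destruct Kf as (Kf & Kf1 & Kf2 & _), Kg as (Kg & Kg1 & Kg2 & _).
  split; unfold polar_pairing_s, polar_pairing_p; cbv zeta; cont2d; trivial. }
split; [| exact Hc].
apply differentiable_of_partials; [| | apply Hc].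
- eapply locally_2d_impl; [| exact (Omega_polar_locally a s p Ha Hs)].
  apply locally_2d_forall; intros u v Huv.
  destruct (is_derive_px_py u v) as (P1 & P2 & _).
  apply (is_derive_pairing (fun t => px t v) (fun t => py t v)
    (fun t => f (px t v, py t v)) (fun t => g (px t v, py t v))); trivial.
  + apply (is_derive_comp_2d (fun x y => f (x, y)) (fun t => px t v) (fun t => py t v));
      trivial; now apply (C1_partials_differentiable a).
  + apply (is_derive_comp_2d (fun x y => g (x, y)) (fun t => px t v) (fun t => py t v));
      trivial; now apply (C1_partials_differentiable a).
- pose proof (Omega_polar a s p Ha Hs) as Hx.
  destruct (is_derive_px_py s p) as (_ & _ & P1 & P2).
  apply (is_derive_pairing (px s) (py s)
    (fun t => f (px s t, py s t)) (fun t => g (px s t, py s t))); trivial.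
  + apply (is_derive_comp_2d (fun x y => f (x, y)) (px s) (py s));
      trivial; now apply (C1_partials_differentiable a).
  + apply (is_derive_comp_2d (fun x y => g (x, y)) (px s) (py s));
      trivial; now apply (C1_partials_differentiable a).
Qed.

Lemma continuity_2d_pt_Rmax (s0 s p : R) : continuity_2d_pt (fun s _ => Rmax s0 s) s p.
Proof.
intros e; exists e; intros u v Hu _; simpl.
apply Rle_lt_trans with (Rabs (u - s)); [| trivial].
unfold Rmax; destruct (Rle_dec s0 u), (Rle_dec s0 s); unfold Rabs;
  repeat destruct (Rcase_abs _); lra.
Qed.

Lemma polar_pairing_clamped (a : R) (f f1 f2 g g1 g2 : R * R -> R) (s p : R) :
  0 < a -> C1_partials a f f1 f2 -> C1_partials a g g1 g2 ->
  continuity_2d_pt (fun s p => polar_pairing f g (Rmax (ln a) s) p) s p.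
Proof.
intros Ha (Hf & _) (Hg & _).
assert (Hx : continuity_2d_pt (fun s p => px (Rmax (ln a) s) p) s p).
{ apply continuity_2d_pt_mult.
  - apply (continuity_1d_2d_pt_comp exp); [| apply continuity_2d_pt_Rmax].
    apply derivable_continuous_pt, derivable_pt_exp.
  - apply (continuity_1d_2d_pt_comp cos); [apply continuity_cos | apply continuity_2d_pt_id2]. }
assert (Hy : continuity_2d_pt (fun s p => py (Rmax (ln a) s) p) s p).
{ apply continuity_2d_pt_mult.
  - apply (continuity_1d_2d_pt_comp exp); [| apply continuity_2d_pt_Rmax].
    apply derivable_continuous_pt, derivable_pt_exp.
  - apply (continuity_1d_2d_pt_comp sin); [apply continuity_sin | apply continuity_2d_pt_id2]. }
(* The clamped radius is at least [a], so the point lies in the closed domain on both sides of the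
   line [s = ln a]. *)
assert (HD : locally_2d (fun s p =>
  closure (Omega a) (px (Rmax (ln a) s) p, py (Rmax (ln a) s) p)) s p).
{ apply locally_2d_forall; intros u v; apply closure_Omega; trivial.
  rewrite enorm_polar; apply Rle_trans with (exp (ln a)); [rewrite exp_ln; lra |].
  destruct (Rmax_l (ln a) u) as [H | <-]; [left; now apply exp_increasing | apply Rle_refl]. }
apply continuity_2d_pt_plus; apply continuity_2d_pt_mult; trivial;
  apply (continuity_2d_comp_on (closure (Omega a))); trivial.
Qed.

Lemma polar_pairing_periodic (f g : R * R -> R) : periodic (polar_pairing f g).
Proof. intros s p; unfold polar_pairing; now rewrite px_periodic, py_periodic. Qed.

Lemma differentiable_clamp (s0 : R) (f : R -> R -> R) (s p l1 l2 : R) :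
  s0 < s -> differentiable_pt_lim f s p l1 l2 ->
  differentiable_pt_lim (fun s p => f (Rmax s0 s) p) s p l1 l2.
Proof.
intros Hs; apply differentiable_pt_lim_ext.
assert (Hd : 0 < s - s0) by lra.
exists (mkposreal _ Hd); simpl; intros u v Hu _.
apply Rabs_def2 in Hu; rewrite Rmax_right; lra.
Qed.

(* [A] and [B] are frozen below [s = ln a], so as to be continuous at that line
   in the two-sided sense. *)
Lemma polar_flow_of_planar (a c : R) (f f1 f2 g g1 g2 : R * R -> R) :
  0 < a -> 0 < c ->
  C1_partials a f f1 f2 -> C1_partials a g g1 g2 ->
  (forall x, Omega a x -> f1 x + g2 x = 0) ->
  (forall x, Omega a x -> g1 x - f2 x <= 0) ->
  (forall x, Omega a x -> c <= enorm (f x, g x)) ->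
  (forall x, circle a x -> dot (f x, g x) (e_r x) = 0) ->
  (forall x, circle a x -> 0 < dot (f x, g x) (e_theta x)) ->
  polar_flow (ln a) c
    (fun s p => polar_pairing f g (Rmax (ln a) s) p)
    (fun s p => polar_pairing g (fun x => - f x) (Rmax (ln a) s) p)
    (polar_pairing_s f f1 f2 g g1 g2)
    (polar_pairing_p f f1 f2 g g1 g2)
    (polar_pairing_s g g1 g2 (fun x => - f x) (fun x => - f1 x) (fun x => - f2 x))
    (polar_pairing_p g g1 g2 (fun x => - f x) (fun x => - f1 x) (fun x => - f2 x)).
Proof.
intros Ha Hc Hf Hg Hdiv Hcurl Hlow Hr Hth.
pose proof (C1_partials_opp a f f1 f2 Hf) as Hnf.
assert (Hcirc : forall p, circle a (px (ln a) p, py (ln a) p)).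
{ intros p; unfold circle; rewrite enorm_polar; now apply exp_ln. }
split; trivial.
- repeat constructor; intros s p; try apply polar_pairing_periodic;
    unfold polar_pairing_s, polar_pairing_p; now rewrite px_periodic, py_periodic.
- intros s p _; repeat constructor.
  + now apply (polar_pairing_clamped a f f1 f2 g g1 g2).
  + now apply (polar_pairing_clamped a g g1 g2 (fun x => - f x)
      (fun x => - f1 x) (fun x => - f2 x)).
- intros s p Hs.
  pose proof (polar_pairing_C1 a f f1 f2 g g1 g2 s p Ha Hf Hg Hs) as [_ [K1 K2]].
  pose proof (polar_pairing_C1 a _ _ _ _ _ _ s p Ha Hg Hnf Hs) as [_ [K3 K4]].
  repeat constructor; trivial.
- intros s p Hs; apply differentiable_clamp; trivial.
  now apply (polar_pairing_C1 a f f1 f2 g g1 g2 s p).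
- intros s p Hs; apply differentiable_clamp; trivial.
  now apply (polar_pairing_C1 a g g1 g2 _ _ _ s p Ha Hg Hnf).
- intros s p Hs; pose proof (Hdiv _ (Omega_polar a s p Ha Hs)) as H.
  unfold polar_pairing_s, polar_pairing_p; cbv zeta.
  (* The undifferentiated terms of the product rule cancel, here and in the curl, leaving the planar
     quantity times [e^(2 s)]. *)
  match goal with |- ?l = 0 =>
    replace l with ((px s p ^ 2 + py s p ^ 2) *
      (f1 (px s p, py s p) + g2 (px s p, py s p))) by ring end.
  rewrite H; ring.
- intros s p Hs; pose proof (Hcurl _ (Omega_polar a s p Ha Hs)) as H.
  unfold polar_pairing_s, polar_pairing_p; cbv zeta.
  match goal with |- ?l <= 0 =>
    replace l with ((px s p ^ 2 + py s p ^ 2) *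
      (g1 (px s p, py s p) - f2 (px s p, py s p))) by ring end.
  assert (0 <= px s p ^ 2 + py s p ^ 2) by nra; nra.
- intros s p Hs; pose proof (Hlow _ (Omega_polar a s p Ha Hs)) as H.
  cbv beta; rewrite Rmax_right by lra.
  set (x := (px s p, py s p)) in *.
  assert (E : Cmod (polar_pairing f g s p, polar_pairing g (fun x => - f x) s p)
    = exp s * enorm (f x, g x)).
  { unfold Cmod, enorm; simpl fst; simpl snd.
    rewrite <- (sqrt_pow2 (exp s)) at 1 by (left; apply exp_pos).
    rewrite <- sqrt_mult_alt by (rewrite <- (px_py_sq s p); nra).
    rewrite <- (px_py_sq s p); f_equal; unfold polar_pairing; fold x; ring. }
  rewrite E, Rmult_comm; apply Rmult_le_compat_l; trivial; left; apply exp_pos.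
- intros p; cbv beta; rewrite Rmax_left by lra.
  specialize (Hr _ (Hcirc p)).
  unfold dot, e_r in Hr; rewrite enorm_polar, (exp_ln a Ha) in Hr; simpl in Hr.
  unfold polar_pairing.
  apply (Rmult_eq_reg_r (/ a)); [| apply Rinv_neq_0_compat; lra].
  rewrite Rmult_0_l, <- Hr; field; lra.
- intros p; cbv beta; rewrite Rmax_left by lra.
  specialize (Hth _ (Hcirc p)).
  unfold dot, e_theta in Hth; rewrite enorm_polar, (exp_ln a Ha) in Hth; simpl in Hth.
  unfold polar_pairing.
  apply Rmult_lt_reg_r with (/ a); [now apply Rinv_0_lt_compat |].
  rewrite Rmult_0_l; eapply Rlt_le_trans; [exact Hth |].
  right; field; lra.
Qed.

(** * Pointwise bounds from extrema, and the two orientations *)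

Lemma inf_on_pos (D : R * R -> Prop) (h : R * R -> R) :
  Rbar_lt 0 (inf_on D h) -> exists c, 0 < c /\ forall x, D x -> c <= h x.
Proof.
unfold inf_on; set (E := fun y => _); intros H.
destruct (Glb_Rbar_correct E) as [Hlb _].
destruct (Glb_Rbar E) as [l| |]; simpl in H; [| | easy].
- exists l; split; trivial; intros x Hx; apply (Hlb (h x)); now exists x.
(* An infinite infimum of a real function means that [D] is empty, so any constant will do. *)
- exists 1; split; [lra |]; intros x Hx.
  destruct (Hlb (h x) (ex_intro _ x (conj Hx eq_refl))).
Qed.

Lemma sup_on_nonpos (D : R * R -> Prop) (h : R * R -> R) :
  ~ Rbar_lt 0 (sup_on D h) -> forall x, D x -> h x <= 0.
Proof.
unfold sup_on; set (E := fun y => _); intros H x Hx.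
destruct (Lub_Rbar_correct E) as [Hub _].
apply Rbar_not_lt_le in H.
exact (Rbar_le_trans (h x) (Lub_Rbar E) 0 (Hub (h x) (ex_intro _ x (conj Hx eq_refl))) H).
Qed.

Lemma inf_on_nonneg (D : R * R -> Prop) (h : R * R -> R) :
  ~ Rbar_lt (inf_on D h) 0 -> forall x, D x -> 0 <= h x.
Proof.
unfold inf_on; set (E := fun y => _); intros H x Hx.
destruct (Glb_Rbar_correct E) as [Hlb _].
apply Rbar_not_lt_le in H.
exact (Rbar_le_trans 0 (Glb_Rbar E) (h x) H (Hlb (h x) (ex_intro _ x (conj Hx eq_refl)))).
Qed.

Theorem theorem1p4 (a : R) (v : R * R -> R * R) :
  0 < a ->
  Ck_closure (Omega a) 2 (comp1 v) ->
  Ck_closure (Omega a) 2 (comp2 v) ->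
  (exists p : R * R -> R, Ck (Omega a) 1 p /\ steady_Euler (Omega a) v p) ->
  (forall x, circle a x -> dot (v x) (e_r x) = 0) ->
  Rbar_lt 0 (inf_on (Omega a) (fun x => enorm (v x))) ->
  ((forall x, circle a x -> 0 < dot (v x) (e_theta x)) ->
     Rbar_lt 0 (sup_on (Omega a) (vorticity v))) /\
  ((forall x, circle a x -> dot (v x) (e_theta x) < 0) ->
     Rbar_lt (inf_on (Omega a) (vorticity v)) 0).
Proof.
intros Ha H1 H2 [q [_ HE]] Hr Hinf.
apply Ck_closure_C1 in H1, H2.
destruct (inf_on_pos _ _ Hinf) as [c [Hc Hlow]].
assert (Hdiv : forall x, Omega a x -> d1 (comp1 v) x + d2 (comp2 v) x = 0).
{ intros x Hx; apply (HE x Hx). }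
split; intros Hth.
- destruct (Rbar_lt_dec 0 (sup_on (Omega a) (vorticity v))) as [|Hn]; trivial.
  pose proof (sup_on_nonpos _ _ Hn) as Hcurl.
  exfalso; eapply no_polar_flow.
  apply (polar_flow_of_planar a c (comp1 v) _ _ (comp2 v) _ _ Ha Hc H1 H2 Hdiv Hcurl).
  + intros x Hx; exact (Hlow x Hx).
  + intros x Hx; exact (Hr x Hx).
  + intros x Hx; exact (Hth x Hx).
(* The reversed flow [- v] is counterclockwise on the inner circle, has the same speed, and has
   nonpositive vorticity. *)
- destruct (Rbar_lt_dec (inf_on (Omega a) (vorticity v)) 0) as [|Hn]; trivial.
  pose proof (inf_on_nonneg _ _ Hn) as Hcurl.
  exfalso; eapply no_polar_flow.
  apply (polar_flow_of_planar a c _ _ _ _ _ _ Ha Hc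
    (C1_partials_opp _ _ _ _ H1) (C1_partials_opp _ _ _ _ H2)).
  + intros x Hx; cbv beta; specialize (Hdiv x Hx); lra.
  + intros x Hx; cbv beta; specialize (Hcurl x Hx); unfold vorticity in Hcurl; lra.
  + intros x Hx; specialize (Hlow x Hx); unfold enorm in *; simpl fst; simpl snd.
    unfold comp1, comp2.
    replace ((- fst (v x)) ^ 2 + (- snd (v x)) ^ 2) with (fst (v x) ^ 2 + snd (v x) ^ 2) by ring.
    exact Hlow.
  + intros x Hx; specialize (Hr x Hx); unfold dot, comp1, comp2 in *; simpl in *; lra.
  + intros x Hx; specialize (Hth x Hx); unfold dot, comp1, comp2 in *; simpl in *; lra.
Qed.
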